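(* Let $0<|q|<1$ and let $a,b,c,d,r,u,v$ be complex numbers with $uv\neq0$ and \[ \max\{|au|,|av|,|bu|,|bv|,|cu|,|cv|,|du|,|dv|,|abr/d|,|abcruv/q|\}<1 . \] For such parameters define \[ \rho(a,b,c,d,r,u,v)=v\sum_{n=0}^\infty\frac{(q/du,\,acuv,\,bcuv;q)_n\,(dv)^n}{(av,\,bv,\,cv;q)_{n+1}}\; {}_3\phi_2\!\left({q^{n+1},\ vq^{n+1}/r,\ q/cu\atop avq^{n+1},\ bvq^{n+1}};q,\ \frac{abcruv}{q}\right), \] and let $\rho(a,b,c,d,r,v,u)$ denote the same expression with $u$ and $v$ interchanged. Then \begin{align*} &\rho(a,b,c,d,r,u,v)-\rho(a,b,c,d,r,v,u)\\ &=\frac{\Delta(u,v)\,(acuv,\,aduv,\,bcuv,\,bduv,\,cduv,\,abr/d;q)_\infty}{(au,\,av,\,bu,\,bv,\,cu,\,cv,\,du,\,dv,\,abcruv/q;q)_\infty}\; {}_3\phi_2\!\left({du,\ dv,\ duv/r\atop aduv,\ bduv};q,\ \frac{abr}{d}\right). \end{align*}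
   Context: Notation: $(a;q)_0=1$, $(a;q)_n=\prod_{k=0}^{n-1}(1-aq^k)$, $(a;q)_\infty=\prod_{k=0}^\infty(1-aq^k)$, and $(a_1,\dots,a_m;q)_n=(a_1;q)_n\cdots(a_m;q)_n$ for $n$ a nonnegative integer or $\infty$. $\Delta(u,v)=v\,(q,\,u/v,\,qv/u;q)_\infty$. ${}_3\phi_2\!\left({a_1,a_2,a_3\atop b_1,b_2};q,z\right)=\sum_{n\ge0}\frac{(a_1,a_2,a_3;q)_n}{(q,b_1,b_2;q)_n}z^n$. *)

(* Defs.v *)
From Stdlib Require Import Reals ClassicalEpsilon.
Open Scope R_scope.

Record CC : Type := mkC { Re : R; Im : R }.

Declare Scope C_scope.
Delimit Scope C_scope with Cx.
Bind Scope C_scope with CC.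

Definition C0 : CC := mkC 0 0.
Definition C1 : CC := mkC 1 0.
Definition Cadd (z w : CC) : CC := mkC (Re z + Re w) (Im z + Im w).
Definition Copp (z : CC) : CC := mkC (- Re z) (- Im z).
Definition Csub (z w : CC) : CC := Cadd z (Copp w).
Definition Cmul (z w : CC) : CC :=
  mkC (Re z * Re w - Im z * Im w) (Re z * Im w + Im z * Re w).
(* inverse; the value at 0 is irrelevant (total function, C0 ^-1 = 0) *)
Definition Cinv (z : CC) : CC :=
  mkC (Re z / (Re z * Re z + Im z * Im z)) (- Im z / (Re z * Re z + Im z * Im z)).
Definition Cdiv (z w : CC) : CC := Cmul z (Cinv w).
Fixpoint Cpow (z : CC) (n : nat) : CC :=
  match n with O => C1 | S k => Cmul z (Cpow z k) end.
Definition Cnorm (z : CC) : R := sqrt (Re z * Re z + Im z * Im z).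

Infix "+" := Cadd : C_scope.
Infix "-" := Csub : C_scope.
Infix "*" := Cmul : C_scope.
Infix "/" := Cdiv : C_scope.
Infix "^" := Cpow : C_scope.

Definition Ccv (u : nat -> CC) (l : CC) : Prop :=
  forall eps : R, eps > 0 -> exists N : nat, forall n : nat, (n >= N)%nat ->
    Cnorm (Csub (u n) l) < eps.

(* the limit of a sequence (chosen by classical choice; meaningful when it converges) *)
Definition Clim (u : nat -> CC) : CC :=
  epsilon (inhabits C0) (fun l => Ccv u l).

Fixpoint Cpartial (f : nat -> CC) (N : nat) : CC :=
  match N with O => C0 | S k => Cadd (Cpartial f k) (f k) end.

Definition Csum (f : nat -> CC) : CC := Clim (Cpartial f).

Fixpoint Cprod (f : nat -> CC) (N : nat) : CC :=
  match N with O => C1 | S k => Cmul (Cprod f k) (f k) end.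

Definition qpoch (a q : CC) (n : nat) : CC :=
  Cprod (fun k => Csub C1 (Cmul a (Cpow q k))) n.
Definition qpoch_inf (a q : CC) : CC := Clim (qpoch a q).

Definition qDelta (q u v : CC) : CC :=
  Cmul v (Cmul (qpoch_inf q q) (Cmul (qpoch_inf (Cdiv u v) q)
                                      (qpoch_inf (Cdiv (Cmul q v) u) q))).

Definition phi32 (a1 a2 a3 b1 b2 q z : CC) : CC :=
  Csum (fun n =>
    Cdiv (Cmul (Cmul (qpoch a1 q n) (Cmul (qpoch a2 q n) (qpoch a3 q n))) (Cpow z n))
         (Cmul (qpoch q q n) (Cmul (qpoch b1 q n) (qpoch b2 q n)))).

Open Scope C_scope.

Definition rho (q a b c d r u v : CC) : CC :=
  v * Csum (fun n =>
    ((qpoch (q / (d * u)) q n * qpoch (a * c * u * v) q n * qpoch (b * c * u * v) q n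
        * (d * v) ^ n)
     / (qpoch (a * v) q (S n) * qpoch (b * v) q (S n) * qpoch (c * v) q (S n)))
    * phi32 (q ^ (S n)) (v * q ^ (S n) / r) (q / (c * u))
            (a * v * q ^ (S n)) (b * v * q ^ (S n)) q
            (a * b * c * r * u * v / q)).

Close Scope C_scope.

(* Main.v *)
From Stdlib Require Import Reals Lra Lia Arith Classical ClassicalEpsilon FunctionalExtensionality.
Require Import Defs.
Open Scope C_scope.

(** A three-term recurrence replaces analytic continuation.  By the q-binomial theorem and
    diagonal summation, a series
      [sum_k (A)_k (A b v q^k)_oo (av,dv)_k / (q,aduv)_k (bu)^k T_k / (bv)_oo]
    equals [sum_n (A)_n b^n / (q)_n D_n], where
      [D_n = sum_k binom(n,k)_q (av,dv)_k / (aduv)_k u^k v^(n-k) T_k].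
    For [T = 1] the [D_n] satisfy a three-term recurrence symmetric in [u] and [v], hence are
    symmetric themselves; this is Gasper-Rahman's transformation (III.9) of a 3phi2.  Applied to
    the inner 3phi2 of [rho], and again after exchanging the two summations, it gives
      [rho(u,v) = K (R(u,v) Psi - E(u,v))],
    where [K] and [Psi] are symmetric, [R] is [rho] at [b = 0] with [c] and [d] exchanged, and [E]
    is the series above with [A = ar] and [T_k] a partial sum of [R].  The corresponding [D_n] satisfy
    the same recurrence with the inhomogeneity [uv (cuv)^n], so [E] is symmetric too and the
    theorem reduces to its case [b = 0]: a product formula for [R(u,v) - R(v,u)].  That formula
    follows from first-order q-shift equations in the parameters, which send them to 0, and
    the last one to [q/u], where [R(u,v)] has a single term and [R(v,u)] telescopes. *)

(** [Csum] is a limit picked by [epsilon], so no rule for series applies before convergence is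
    known. Every series therefore gets a geometric majorant, and where a parameter tends to 0 the
    majorant is uniform in it. The exchange of [c] and [d] is forced by the double series. For fixed
    k, the sum over n has ratio d v q^k and is no tail of a fixed series. After the exchange the
    ratio is c v, and the powers q^k sit only in the shifted factorials, where they amount to an
    index shift by k. A tail is the full sum minus a partial sum, and this is where [T_k] comes
    from. The recurrence for the partial sums closes because summation by parts lets [T] enter only
    through its increments. Those cancel every denominator of the telescoping certificate, and a
    q-binomial expansion of (cuv)^n remains. In the b = 0 case neither series alone satisfies a
    homogeneous shift equation; the inhomogeneities cancel only in the difference. This is why the
    product formula exists for [R(u,v) - R(v,u)] and is proved for it directly. *)

Lemma CC_eq (z w : CC) : Re z = Re w -> Im z = Im w -> z = w.
Proof. destruct z, w; simpl; intros; subst; reflexivity. Qed.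

Lemma CC_normsq_pos (z : CC) : z <> C0 -> (0 < Re z * Re z + Im z * Im z)%R.
Proof.
  intros Hz.
  destruct (Req_dec (Re z) 0) as [Hr|Hr]; [|nra].
  destruct (Req_dec (Im z) 0) as [Hi|Hi]; [|nra].
  exfalso; apply Hz; apply CC_eq; assumption.
Qed.

Lemma CC_field_theory : field_theory C0 C1 Cadd Cmul Csub Copp Cdiv Cinv eq.
Proof.
  split.
  - split; intros; apply CC_eq; simpl; ring.
  - intro H; injection H; lra.
  - reflexivity.
  - intros z Hz. apply CC_normsq_pos in Hz.
    apply CC_eq; simpl; field; lra.
Qed.

Add Field CC_field : CC_field_theory.

(** * Modulus, powers and nonvanishing *)

Lemma Cnorm_ge0 z : (0 <= Cnorm z)%R.
Proof. apply sqrt_pos. Qed.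

Lemma Cnorm_mul z w : Cnorm (z * w) = (Cnorm z * Cnorm w)%R.
Proof.
  unfold Cnorm; rewrite <- sqrt_mult by nra.
  f_equal; simpl; ring.
Qed.

Lemma Cnorm_C1 : Cnorm C1 = 1%R.
Proof. unfold Cnorm; simpl. replace (1 * 1 + 0 * 0)%R with 1%R by ring. apply sqrt_1. Qed.

Lemma Cnorm_C0 : Cnorm C0 = 0%R.
Proof. unfold Cnorm; simpl. replace (0 * 0 + 0 * 0)%R with 0%R by ring. apply sqrt_0. Qed.

Lemma Cnorm_gt0 z : z <> C0 -> (0 < Cnorm z)%R.
Proof. intros H; apply sqrt_lt_R0, CC_normsq_pos, H. Qed.

Lemma Cnorm_gt0_neq z : (0 < Cnorm z)%R -> z <> C0.
Proof. intros H ->; rewrite Cnorm_C0 in H; lra. Qed.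

Lemma Cnorm_opp z : Cnorm (Copp z) = Cnorm z.
Proof. unfold Cnorm; f_equal; simpl; ring. Qed.

Lemma Cnorm_add z w : (Cnorm (z + w) <= Cnorm z + Cnorm w)%R.
Proof.
  destruct z as [a b], w as [c d]; unfold Cnorm; simpl.
  pose proof (sqrt_pos (a * a + b * b)) as P1.
  pose proof (sqrt_pos (c * c + d * d)) as P2.
  pose proof (sqrt_sqrt (a * a + b * b) ltac:(nra)) as S1.
  pose proof (sqrt_sqrt (c * c + d * d) ltac:(nra)) as S2.
  set (x := sqrt (a * a + b * b)) in *.
  set (y := sqrt (c * c + d * d)) in *.
  (* Cauchy-Schwarz, from (a^2 + b^2)(c^2 + d^2) - (ac + bd)^2 = (ad - bc)^2. *)
  assert (a * c + b * d <= x * y)%R as CS.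
  { apply Rsqr_incr_0_var; [|apply Rmult_le_pos; assumption].
    unfold Rsqr.
    replace (x * y * (x * y))%R with ((x * x) * (y * y))%R by ring.
    rewrite S1, S2.
    assert (0 <= (a * d - b * c) * (a * d - b * c))%R by apply Rle_0_sqr. nra. }
  rewrite <- (sqrt_square (x + y)) by lra.
  apply sqrt_le_1_alt.
  replace ((x + y) * (x + y))%R with (x * x + y * y + 2 * (x * y))%R by ring. nra.
Qed.

Lemma Cnorm_sub z w : (Cnorm (z - w) <= Cnorm z + Cnorm w)%R.
Proof. unfold Csub; rewrite <- (Cnorm_opp w); apply Cnorm_add. Qed.

Lemma Cnorm_inv z : z <> C0 -> Cnorm (Cinv z) = (/ Cnorm z)%R.
Proof.
  intros Hz. pose proof (Cnorm_gt0 z Hz).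
  apply Rmult_eq_reg_l with (Cnorm z); [|lra].
  rewrite <- Cnorm_mul, Rinv_r by lra.
  rewrite <- Cnorm_C1; f_equal; field; assumption.
Qed.

Lemma Cnorm_pow z n : Cnorm (z ^ n) = (Cnorm z ^ n)%R.
Proof.
  induction n as [|n IH]; simpl; [apply Cnorm_C1|].
  rewrite Cnorm_mul, IH; reflexivity.
Qed.

Lemma Re_le_Cnorm z : (Rabs (Re z) <= Cnorm z)%R.
Proof.
  unfold Cnorm. rewrite <- sqrt_Rsqr_abs. apply sqrt_le_1_alt; unfold Rsqr; nra.
Qed.

Lemma Im_le_Cnorm z : (Rabs (Im z) <= Cnorm z)%R.
Proof.
  unfold Cnorm. rewrite <- sqrt_Rsqr_abs. apply sqrt_le_1_alt; unfold Rsqr; nra.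
Qed.

Lemma Cnorm_le_Re_Im z : (Cnorm z <= Rabs (Re z) + Rabs (Im z))%R.
Proof.
  replace z with (mkC (Re z) 0 + mkC 0 (Im z)) at 1
    by (apply CC_eq; simpl; ring).
  eapply Rle_trans; [apply Cnorm_add|].
  apply Rplus_le_compat; unfold Cnorm; simpl; rewrite <- sqrt_Rsqr_abs;
    apply Req_le; f_equal; unfold Rsqr; ring.
Qed.

Lemma Cmul_neq0 z w : z <> C0 -> w <> C0 -> z * w <> C0.
Proof.
  intros Hz Hw; apply Cnorm_gt0_neq; rewrite Cnorm_mul.
  apply Rmult_lt_0_compat; apply Cnorm_gt0; assumption.
Qed.

Lemma Cpow_neq0 z n : z <> C0 -> z ^ n <> C0.
Proof.
  intros Hz; induction n as [|n IH]; simpl; [|apply Cmul_neq0; assumption].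
  intro H; injection H; lra.
Qed.

Lemma Cpow_add z n m : z ^ (n + m) = z ^ n * z ^ m.
Proof. induction n as [|n IH]; simpl; [|rewrite IH]; ring. Qed.

Lemma Cpow_mul_base z w n : (z * w) ^ n = z ^ n * w ^ n.
Proof. induction n as [|n IH]; simpl; [|rewrite IH]; ring. Qed.

Lemma Cpow_pow_comm z n m : (z ^ n) ^ m = (z ^ m) ^ n.
Proof.
  induction n as [|n IH]; simpl.
  - induction m as [|m IHm]; simpl; [|rewrite IHm]; ring.
  - rewrite Cpow_mul_base, IH; reflexivity.
Qed.

Lemma Csub_neq0 z w : z <> w -> z - w <> C0.
Proof.
  intros H E; apply H. replace z with ((z - w) + w) by ring. rewrite E; ring.
Qed.

Lemma one_sub_neq0 z : (Cnorm z < 1)%R -> C1 - z <> C0.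
Proof.
  intros H; apply Csub_neq0; intros <-; rewrite Cnorm_C1 in H; lra.
Qed.

(** * Limits and dominated series *)

Lemma Ccv_unique u l l' : Ccv u l -> Ccv u l' -> l = l'.
Proof.
  intros H H'. destruct (classic (l = l')) as [E|Hne]; [exact E|exfalso].
  assert (0 < Cnorm (l - l'))%R as P by (apply Cnorm_gt0, Csub_neq0, Hne).
  destruct (H (Cnorm (l - l') / 2)%R) as [N HN]; [lra|].
  destruct (H' (Cnorm (l - l') / 2)%R) as [N' HN']; [lra|].
  specialize (HN (max N N') ltac:(lia)). specialize (HN' (max N N') ltac:(lia)).
  set (x := u (max N N')) in *.
  pose proof (Cnorm_sub (x - l') (x - l)) as T.
  replace (x - l' - (x - l)) with (l - l') in T by ring. lra.
Qed.

Lemma Clim_eq u l : Ccv u l -> Clim u = l.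
Proof.
  intros H. apply Ccv_unique with u; [|exact H].
  unfold Clim; apply epsilon_spec; exists l; exact H.
Qed.

Lemma Ccv_const z : Ccv (fun _ => z) z.
Proof.
  intros e He; exists 0%nat; intros n _.
  replace (z - z) with C0 by ring. rewrite Cnorm_C0; lra.
Qed.

Lemma Ccv_ext u v l : (forall n, u n = v n) -> Ccv u l -> Ccv v l.
Proof.
  intros E H e He; destruct (H e He) as [N HN]; exists N; intros n Hn.
  rewrite <- E; auto.
Qed.

Lemma Ccv_add u v l m : Ccv u l -> Ccv v m -> Ccv (fun n => u n + v n) (l + m).
Proof.
  intros H H' e He.
  destruct (H (e / 2)%R) as [N HN]; [lra|].
  destruct (H' (e / 2)%R) as [N' HN']; [lra|].
  exists (max N N'); intros n Hn.
  specialize (HN n ltac:(lia)); specialize (HN' n ltac:(lia)).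
  replace (u n + v n - (l + m)) with ((u n - l) + (v n - m)) by ring.
  pose proof (Cnorm_add (u n - l) (v n - m)); lra.
Qed.

Lemma Ccv_scal z u l : Ccv u l -> Ccv (fun n => z * u n) (z * l).
Proof.
  intros H e He. pose proof (Cnorm_ge0 z).
  destruct (H (e / (Cnorm z + 1))%R) as [N HN].
  { apply Rdiv_lt_0_compat; lra. }
  exists N; intros n Hn; specialize (HN n Hn).
  replace (z * u n - z * l) with (z * (u n - l)) by ring.
  rewrite Cnorm_mul.
  apply Rmult_lt_compat_r with (r := (Cnorm z + 1)%R) in HN; [|lra].
  unfold Rdiv in HN; rewrite Rmult_assoc, Rinv_l in HN by lra.
  pose proof (Cnorm_ge0 (u n - l)). nra.
Qed.

Lemma Ccv_shift k u l : Ccv u l -> Ccv (fun n => u (n + k)%nat) l.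
Proof.
  intros H e He; destruct (H e He) as [N HN]; exists N; intros n Hn; apply HN; lia.
Qed.

Lemma Ccv_unshift k u l : Ccv (fun n => u (n + k)%nat) l -> Ccv u l.
Proof.
  intros H e He; destruct (H e He) as [N HN]; exists (N + k)%nat; intros n Hn.
  replace n with ((n - k) + k)%nat by lia. apply HN; lia.
Qed.

Lemma Ccv_bounded u l : Ccv u l -> exists M, forall n, (Cnorm (u n) <= M)%R.
Proof.
  intros H; destruct (H 1%R ltac:(lra)) as [N HN].
  assert (forall K, exists M, forall n, (n < K)%nat -> (Cnorm (u n) <= M)%R) as B.
  { induction K as [|K [M HM]]; [exists 0%R; intros; lia|].
    exists (Rmax M (Cnorm (u K))); intros n Hn.
    destruct (Nat.eq_dec n K) as [->|]; [apply Rmax_r|].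
    eapply Rle_trans; [apply HM; lia|apply Rmax_l]. }
  destruct (B N) as [M HM]; exists (Rmax M (Cnorm l + 1)); intros n.
  destruct (lt_dec n N); [eapply Rle_trans; [apply HM; lia|apply Rmax_l]|].
  eapply Rle_trans; [|apply Rmax_r].
  specialize (HN n ltac:(lia)).
  pose proof (Cnorm_add (u n - l) l) as T.
  replace (u n - l + l) with (u n) in T by ring. lra.
Qed.

Lemma Ccv_mul u v l m : Ccv u l -> Ccv v m -> Ccv (fun n => u n * v n) (l * m).
Proof.
  intros H H'. destruct (Ccv_bounded _ _ H') as [M HM].
  assert (Ccv (fun n => (u n - l) * v n) C0) as H1.
  { intros e He.
    assert (0 <= M)%R by (eapply Rle_trans; [apply (Cnorm_ge0 (v O))|apply HM]).
    destruct (H (e / (M + 1))%R) as [N HN]; [apply Rdiv_lt_0_compat; lra|].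
    exists N; intros n Hn; specialize (HN n Hn).
    replace ((u n - l) * v n - C0) with ((u n - l) * v n) by ring.
    rewrite Cnorm_mul. specialize (HM n).
    apply Rmult_lt_compat_r with (r := (M + 1)%R) in HN; [|lra].
    unfold Rdiv in HN; rewrite Rmult_assoc, Rinv_l in HN by lra.
    pose proof (Cnorm_ge0 (u n - l)). nra. }
  apply Ccv_ext with (fun n => (u n - l) * v n + l * v n); [intros; ring|].
  replace (l * m) with (C0 + l * m) by ring.
  apply Ccv_add; [exact H1|apply Ccv_scal, H'].
Qed.

Lemma Ccv_norm_le u l M : Ccv u l -> (forall n, (Cnorm (u n) <= M)%R) -> (Cnorm l <= M)%R.
Proof.
  intros H HM; apply Rnot_lt_le; intro L.
  destruct (H (Cnorm l - M)%R ltac:(lra)) as [N HN]; specialize (HN N (le_n N)).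
  specialize (HM N). pose proof (Cnorm_sub (u N) (u N - l)) as T.
  replace (u N - (u N - l)) with l in T by ring. lra.
Qed.

Lemma Ccv_norm_ge u l M : Ccv u l -> (forall n, (M <= Cnorm (u n))%R) -> (M <= Cnorm l)%R.
Proof.
  intros H HM; apply Rnot_lt_le; intro L.
  destruct (H (M - Cnorm l)%R ltac:(lra)) as [N HN]; specialize (HN N (le_n N)).
  specialize (HM N). pose proof (Cnorm_add (u N - l) l) as T.
  replace (u N - l + l) with (u N) in T by ring. lra.
Qed.

Lemma Ccv_inv u l : Ccv u l -> l <> C0 -> (forall n, u n <> C0) ->
  Ccv (fun n => Cinv (u n)) (Cinv l).
Proof.
  intros H Hl Hu. pose proof (Cnorm_gt0 l Hl) as Pl.
  intros e He.
  (* The first bound gives |u_n| > |l|/2; the second then makes |u_n - l| / (|u_n| |l|) smaller than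
     e. *)
  destruct (H (Rmin (Cnorm l / 2) (e * (Cnorm l * Cnorm l / 2))))%R as [N HN].
  { apply Rmin_glb_lt; [lra|]. apply Rmult_lt_0_compat; [lra|]. nra. }
  exists N; intros n Hn; specialize (HN n Hn).
  pose proof (Rmin_l (Cnorm l / 2) (e * (Cnorm l * Cnorm l / 2))).
  pose proof (Rmin_r (Cnorm l / 2) (e * (Cnorm l * Cnorm l / 2))).
  pose proof (Cnorm_sub (u n) (u n - l)) as T.
  replace (u n - (u n - l)) with l in T by ring.
  replace (Cinv (u n) - Cinv l) with (Copp (u n - l) * Cinv (u n * l))
    by (field; split; auto).
  rewrite Cnorm_mul, Cnorm_opp, Cnorm_inv, Cnorm_mul by (apply Cmul_neq0; auto).
  assert (0 < Cnorm (u n) * Cnorm l)%R by (apply Rmult_lt_0_compat; lra).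
  apply Rmult_lt_reg_r with (Cnorm (u n) * Cnorm l)%R; [assumption|].
  rewrite Rmult_assoc, Rinv_l by lra.
  assert (e * (Cnorm l / 2 * Cnorm l) <= e * (Cnorm (u n) * Cnorm l))%R; [|lra].
  apply Rmult_le_compat_l; [lra|]. apply Rmult_le_compat_r; lra.
Qed.

Lemma Ccv_pow0 z : (Cnorm z < 1)%R -> Ccv (fun n => z ^ n) C0.
Proof.
  intros Hz e He.
  destruct (pow_lt_1_zero (Cnorm z)) with (y := e) as [N HN]; [|exact He|].
  { rewrite Rabs_pos_eq; [exact Hz|apply Cnorm_ge0]. }
  exists N; intros n Hn; specialize (HN n Hn).
  replace (z ^ n - C0) with (z ^ n) by ring.
  rewrite Cnorm_pow. rewrite Rabs_pos_eq in HN; [exact HN|].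
  apply pow_le, Cnorm_ge0.
Qed.

Fixpoint Rpartial (f : nat -> R) (N : nat) : R :=
  match N with O => 0%R | S k => (Rpartial f k + f k)%R end.

(** Bounded partial sums suffice for nonnegative terms, and a single such majorant can serve a whole
    family of series, as [Csum_Tannery] requires. *)
Definition summable (M : nat -> R) : Prop :=
  (forall n, (0 <= M n)%R) /\ exists S, forall N, (Rpartial M N <= S)%R.

Definition dominated (f : nat -> CC) : Prop :=
  exists M, summable M /\ forall n, (Cnorm (f n) <= M n)%R.

Lemma summable_lim M : summable M -> exists S, Un_cv (Rpartial M) S /\
  forall N, (Rpartial M N <= S)%R.
Proof.
  intros [H0 [S HS]].
  assert (Un_growing (Rpartial M)) as G by (intro n; simpl; specialize (H0 n); lra).
  destruct (growing_cv _ G) as [l Hl].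
  { exists S; intros x [n ->]; apply HS. }
  exists l; split; [exact Hl|apply growing_ineq; assumption].
Qed.

Lemma Cpartial_sub_le M f n k : (forall n, (Cnorm (f n) <= M n)%R) ->
  (Cnorm (Cpartial f (n + k) - Cpartial f n) <= Rpartial M (n + k) - Rpartial M n)%R.
Proof.
  intros H; induction k as [|k IH].
  - rewrite Nat.add_0_r. replace (Cpartial f n - Cpartial f n) with C0 by ring.
    rewrite Cnorm_C0; lra.
  - rewrite Nat.add_succ_r; simpl.
    replace (Cpartial f (n + k) + f (n + k)%nat - Cpartial f n)
      with ((Cpartial f (n + k) - Cpartial f n) + f (n + k)%nat) by ring.
    eapply Rle_trans; [apply Cnorm_add|]. specialize (H (n + k)%nat). lra.
Qed.

Lemma Csum_cv f : dominated f -> Ccv (Cpartial f) (Csum f).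
Proof.
  intros [M [HM Hf]].
  destruct (summable_lim M HM) as [S [HS _]].
  assert (forall e, (e > 0)%R -> exists N, forall n m, (n >= N)%nat -> (m >= N)%nat ->
    (Cnorm (Cpartial f n - Cpartial f m) < e)%R) as CA.
  { intros e He. destruct (CV_Cauchy (Rpartial M) (exist _ S HS) e He) as [N HN].
    assert (forall n k, (n >= N)%nat -> (Cnorm (Cpartial f (n + k) - Cpartial f n) < e)%R) as A.
    { intros n k Hn. eapply Rle_lt_trans; [apply (Cpartial_sub_le M); exact Hf|].
      specialize (HN (n + k)%nat n ltac:(lia) Hn). unfold Rdist in HN.
      eapply Rle_lt_trans; [apply Rle_abs|exact HN]. }
    exists N; intros n m Hn Hm.
    destruct (le_lt_dec n m).
    - rewrite <- Cnorm_opp. replace m with (n + (m - n))%nat by lia.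
      replace (Copp (Cpartial f n - Cpartial f (n + (m - n))))
        with (Cpartial f (n + (m - n)) - Cpartial f n) by ring.
      apply A, Hn.
    - replace n with (m + (n - m))%nat by lia. apply A, Hm. }
  destruct (R_complete (fun n => Re (Cpartial f n))) as [x Hx].
  { intros e He; destruct (CA e He) as [N HN]; exists N; intros n m Hn Hm.
    eapply Rle_lt_trans; [|apply (HN n m Hn Hm)].
    unfold Rdist. apply (Re_le_Cnorm (Cpartial f n - Cpartial f m)). }
  destruct (R_complete (fun n => Im (Cpartial f n))) as [y Hy].
  { intros e He; destruct (CA e He) as [N HN]; exists N; intros n m Hn Hm.
    eapply Rle_lt_trans; [|apply (HN n m Hn Hm)].
    unfold Rdist. apply (Im_le_Cnorm (Cpartial f n - Cpartial f m)). }
  assert (Ccv (Cpartial f) (mkC x y)) as H.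
  { intros e He.
    destruct (Hx (e / 2)%R ltac:(lra)) as [N HN].
    destruct (Hy (e / 2)%R ltac:(lra)) as [N' HN'].
    exists (max N N'); intros n Hn.
    specialize (HN n ltac:(lia)); specialize (HN' n ltac:(lia)).
    unfold Rdist in *.
    eapply Rle_lt_trans; [apply Cnorm_le_Re_Im|]. simpl.
    unfold Rminus in HN, HN'. lra. }
  unfold Csum; rewrite (Clim_eq _ _ H); exact H.
Qed.

Lemma Csum_ext f g : (forall n, f n = g n) -> Csum f = Csum g.
Proof. intros H; f_equal; apply functional_extensionality, H. Qed.

Lemma Cpartial_ext f g N : (forall n, (n < N)%nat -> f n = g n) -> Cpartial f N = Cpartial g N.
Proof.
  induction N as [|N IH]; intros H; simpl; [reflexivity|].
  rewrite IH by (intros; apply H; lia). rewrite H by lia. reflexivity.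
Qed.

Lemma Cpartial_add f g N : Cpartial (fun n => f n + g n) N = Cpartial f N + Cpartial g N.
Proof. induction N as [|N IH]; simpl; [|rewrite IH]; ring. Qed.

Lemma Cpartial_scal z f N : Cpartial (fun n => z * f n) N = z * Cpartial f N.
Proof. induction N as [|N IH]; simpl; [|rewrite IH]; ring. Qed.

Lemma Cpartial_recl f N : Cpartial f (S N) = f O + Cpartial (fun n => f (S n)) N.
Proof.
  induction N as [|N IH]; [simpl; ring|].
  change (Cpartial f (S (S N))) with (Cpartial f (S N) + f (S N)).
  rewrite IH; simpl; ring.
Qed.

Lemma Cpartial_split f N k :
  Cpartial f (N + k) = Cpartial f N + Cpartial (fun n => f (N + n)%nat) k.
Proof.
  induction k as [|k IH]; simpl; [rewrite Nat.add_0_r; ring|].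
  rewrite Nat.add_succ_r; simpl; rewrite IH; ring.
Qed.

Lemma Cpartial_telescope g N : Cpartial (fun n => g (S n) - g n) N = g N - g O.
Proof. induction N as [|N IH]; simpl; [|rewrite IH]; ring. Qed.

Lemma Cpartial_zero f N : (forall n, (n < N)%nat -> f n = C0) -> Cpartial f N = C0.
Proof.
  induction N as [|N IH]; intros H; simpl; [reflexivity|].
  rewrite IH by (intros; apply H; lia). rewrite H by lia. ring.
Qed.

Lemma dominated_ext f g : (forall n, f n = g n) -> dominated f -> dominated g.
Proof. intros H [M [HM Hf]]; exists M; split; [exact HM|]. intros n; rewrite <- H; auto. Qed.

Lemma summable_scal c M : (0 <= c)%R -> summable M -> summable (fun n => c * M n)%R.
Proof.
  intros Hc [H0 [S HS]]; split; [intro; apply Rmult_le_pos; auto|].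
  exists (c * S)%R; intro N.
  replace (Rpartial (fun n => c * M n)%R N) with (c * Rpartial M N)%R.
  - apply Rmult_le_compat_l; auto.
  - induction N as [|N IH]; simpl; [|rewrite <- IH]; ring.
Qed.

Lemma dominated_scal z f : dominated f -> dominated (fun n => z * f n).
Proof.
  intros [M [HM Hf]]; exists (fun n => Cnorm z * M n)%R; split.
  - apply summable_scal; [apply Cnorm_ge0|exact HM].
  - intro n; rewrite Cnorm_mul; apply Rmult_le_compat_l; [apply Cnorm_ge0|auto].
Qed.

Lemma Csum_scal z f : dominated f -> Csum (fun n => z * f n) = z * Csum f.
Proof.
  intros H; apply Clim_eq.
  apply Ccv_ext with (fun n => z * Cpartial f n); [intros; symmetry; apply Cpartial_scal|].
  apply Ccv_scal, Csum_cv, H.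
Qed.

Lemma Csum_add f g : dominated f -> dominated g ->
  Csum (fun n => f n + g n) = Csum f + Csum g.
Proof.
  intros H H'; apply Clim_eq.
  apply Ccv_ext with (fun n => Cpartial f n + Cpartial g n);
    [intros; symmetry; apply Cpartial_add|].
  apply Ccv_add; apply Csum_cv; assumption.
Qed.

Lemma Csum_tail f k : dominated f -> Csum (fun n => f (k + n)%nat) = Csum f - Cpartial f k.
Proof.
  intros H; apply Clim_eq.
  apply Ccv_ext with (fun n => Cpartial f (n + k) + Copp (Cpartial f k)).
  - intros n; rewrite Nat.add_comm, Cpartial_split; ring.
  - apply Ccv_add; [apply Ccv_shift, Csum_cv, H|apply Ccv_const].
Qed.

Lemma Csum_telescope g l : Ccv g l -> Csum (fun n => g (S n) - g n) = l - g O.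
Proof.
  intros H; apply Clim_eq.
  apply Ccv_ext with (fun n => g n + Copp (g O)).
  - intros n; rewrite Cpartial_telescope; ring.
  - apply Ccv_add; [exact H|apply Ccv_const].
Qed.

Lemma summable_geom x : (0 <= x < 1)%R -> summable (fun n => x ^ n)%R.
Proof.
  intros Hx; split; [intro; apply pow_le; lra|].
  exists (/ (1 - x))%R; intro N.
  assert (Rpartial (fun n => x ^ n)%R N * (1 - x) = 1 - x ^ N)%R as E.
  { induction N as [|N IH]; simpl; [ring|]. rewrite Rmult_plus_distr_r, IH; ring. }
  apply Rmult_le_reg_r with (1 - x)%R; [lra|].
  rewrite E, Rinv_l by lra. pose proof (pow_le x N); lra.
Qed.

Lemma dominated_geom c z f : (Cnorm z < 1)%R -> (forall n, (Cnorm (f n) <= c * Cnorm z ^ n)%R) ->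
  dominated f.
Proof.
  intros Hz Hf; exists (fun n => (c * Cnorm z ^ n)%R); split; [|exact Hf].
  apply summable_scal; [|apply summable_geom; split; [apply Cnorm_ge0|exact Hz]].
  specialize (Hf O); simpl in Hf. pose proof (Cnorm_ge0 (f O)). lra.
Qed.

Lemma Ccv_geom c z f : (Cnorm z < 1)%R -> (forall n, (Cnorm (f n) <= c * Cnorm z ^ n)%R) ->
  Ccv f C0.
Proof.
  intros Hz Hf e He. pose proof (Cnorm_ge0 (f O)) as H0. pose proof (Hf O) as H1; simpl in H1.
  destruct (Ccv_pow0 z Hz (e / (c + 1))%R) as [N HN]; [apply Rdiv_lt_0_compat; lra|].
  exists N; intros n Hn; specialize (HN n Hn); specialize (Hf n).
  replace (z ^ n - C0) with (z ^ n) in HN by ring. rewrite Cnorm_pow in HN.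
  replace (f n - C0) with (f n) by ring.
  apply Rmult_lt_compat_r with (r := (c + 1)%R) in HN; [|lra].
  unfold Rdiv in HN; rewrite Rmult_assoc, Rinv_l in HN by lra.
  assert (0 <= Cnorm z ^ n)%R by (apply pow_le, Cnorm_ge0). nra.
Qed.

(** The form in which shift equations are proved: [s] and [t] are the terms of one series at two
    parameter values, [g] is a telescoping certificate, and the boundary values of [g] give the
    inhomogeneity. *)
Lemma Csum_telescope2 s t al be g l : dominated s -> dominated t ->
  (forall n, al * s n + be * t n = g (S n) - g n) -> Ccv g l ->
  al * Csum s + be * Csum t = l - g O.
Proof.
  intros Hs Ht E Hg. apply Ccv_unique with (fun n => al * Cpartial s n + be * Cpartial t n).
  - apply Ccv_add; apply Ccv_scal, Csum_cv; assumption.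
  - apply Ccv_ext with (fun n => g n + Copp (g O)).
    + intro n. rewrite <- !Cpartial_scal, <- Cpartial_add.
      rewrite (Cpartial_ext _ (fun n => g (S n) - g n)) by (intros; apply E).
      rewrite Cpartial_telescope; ring.
    + apply Ccv_add; [exact Hg|apply Ccv_const].
Qed.

Lemma Csum_single f : (forall n, f (S n) = C0) -> Csum f = f O.
Proof.
  intros H; apply Clim_eq, (Ccv_unshift 1).
  apply Ccv_ext with (fun _ => f O); [|apply Ccv_const].
  intro n; rewrite Nat.add_1_r, Cpartial_recl, Cpartial_zero; [ring|auto].
Qed.

Lemma Ccv_pow u l m : Ccv u l -> Ccv (fun j => u j ^ m) (l ^ m).
Proof.
  intros H; induction m as [|m IH]; [apply (Ccv_const C1)|].
  simpl; apply Ccv_mul; assumption.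
Qed.

(** Dominated convergence. Beyond index N every series involved has a tail of at most
    [S - Rpartial M N], uniformly in j, while the first N terms converge one by one. *)
Lemma Csum_Tannery (F : nat -> nat -> CC) f M :
  summable M -> (forall j n, (Cnorm (F j n) <= M n)%R) ->
  (forall n, Ccv (fun j => F j n) (f n)) ->
  Ccv (fun j => Csum (F j)) (Csum f).
Proof.
  intros HM HF Hcv.
  assert (forall n, (Cnorm (f n) <= M n)%R) as Hf.
  { intro n; apply Ccv_norm_le with (fun j => F j n); auto. }
  destruct (summable_lim M HM) as [S [HS HSle]].
  assert (forall g N, (forall n, (Cnorm (g n) <= M n)%R) ->
    (Cnorm (Csum g - Cpartial g N) <= S - Rpartial M N)%R) as T.
  { intros g N Hg.
    apply Ccv_norm_le with (fun k => Cpartial g (k + N) + Copp (Cpartial g N)).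
    - apply Ccv_add; [|apply Ccv_const].
      apply Ccv_shift, Csum_cv; exists M; auto.
    - intro k. rewrite Nat.add_comm.
      eapply Rle_trans; [apply (Cpartial_sub_le M g N k Hg)|].
      specialize (HSle (N + k)%nat); lra. }
  assert (forall N, Ccv (fun j => Cpartial (F j) N) (Cpartial f N)) as P.
  { induction N as [|N IH]; simpl; [apply Ccv_const|apply Ccv_add; auto]. }
  intros e He.
  destruct (HS (e / 3)%R ltac:(lra)) as [N HN]; specialize (HN N (le_n N)).
  unfold Rdist in HN; rewrite Rabs_minus_sym in HN.
  pose proof (Rle_abs (S - Rpartial M N)).
  destruct (P N (e / 3)%R ltac:(lra)) as [J HJ]; exists J; intros j Hj.
  specialize (HJ j Hj).
  pose proof (T (F j) N (HF j)). pose proof (T f N Hf).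
  replace (Csum (F j) - Csum f) with
    ((Csum (F j) - Cpartial (F j) N) + (Cpartial (F j) N - Cpartial f N)
       - (Csum f - Cpartial f N)) by ring.
  eapply Rle_lt_trans; [apply Cnorm_sub|].
  pose proof (Cnorm_add (Csum (F j) - Cpartial (F j) N) (Cpartial (F j) N - Cpartial f N)).
  lra.
Qed.

(** * Double series with a product majorant *)

Section DoubleSeries.

Variables (F : nat -> nat -> CC) (A B : nat -> R).
Hypothesis HA : summable A.
Hypothesis HB : summable B.
Hypothesis HF : forall n k, (Cnorm (F n k) <= A n * B k)%R.

Lemma dominated_row n : dominated (F n).
Proof.
  exists (fun k => A n * B k)%R; split; [apply summable_scal; [apply HA|exact HB]|apply HF].
Qed.

Lemma dominated_col k : dominated (fun n => F n k).
Proof.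
  exists (fun n => B k * A n)%R; split; [apply summable_scal; [apply HB|exact HA]|].
  intro n; rewrite Rmult_comm; apply HF.
Qed.

Lemma row_bound : exists SB, (0 <= SB)%R /\ forall n N, (Cnorm (Cpartial (F n) N) <= SB * A n)%R.
Proof.
  destruct HB as [B0 [S HS]]. exists S; split; [apply (HS O)|].
  intros n N.
  pose proof (Cpartial_sub_le (fun k => A n * B k)%R (F n) 0 N (HF n)) as T; simpl in T.
  replace (Cpartial (F n) N - C0) with (Cpartial (F n) N) in T by ring.
  assert (Rpartial (fun k => A n * B k)%R N = A n * Rpartial B N)%R as E.
  { clear. induction N as [|N IH]; simpl; [|rewrite IH]; ring. }
  rewrite E in T. specialize (HS N). destruct HA as [A0 _]; specialize (A0 n). nra.
Qed.

Lemma dominated_rowsum : dominated (fun n => Csum (F n)).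
Proof.
  destruct row_bound as [SB [SB0 HSB]].
  exists (fun n => SB * A n)%R; split; [apply summable_scal; assumption|].
  intro n; apply Ccv_norm_le with (Cpartial (F n)); [apply Csum_cv, dominated_row|auto].
Qed.

(** The K-th partial sum of the column sums is the sum over n of the row partial sums. These are
    bounded by [SB * A n] for every K, so K may tend to infinity under the sum. *)
Lemma Csum_swap :
  Csum (fun n => Csum (F n)) = Csum (fun k => Csum (fun n => F n k)).
Proof.
  symmetry; apply Clim_eq.
  destruct row_bound as [SB [SB0 HSB]].
  apply Ccv_ext with (fun K => Csum (fun n => Cpartial (F n) K)).
  - induction n as [|K IH]; simpl.
    + apply Clim_eq, Ccv_ext with (fun _ => C0); [|apply Ccv_const].
      intro n; symmetry; apply Cpartial_zero; reflexivity.
    + rewrite Csum_add, IH; [reflexivity| |apply dominated_col].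
      exists (fun n => SB * A n)%R; split; [apply summable_scal; assumption|].
      intro n; apply HSB.
  - apply Csum_Tannery with (fun n => SB * A n)%R.
    + apply summable_scal; assumption.
    + intros j n; apply HSB.
    + intro n; apply Csum_cv, dominated_row.
Qed.

Lemma Csum_diagonal :
  Csum (fun n => Csum (F n)) = Csum (fun m => Cpartial (fun k => F k (m - k)%nat) (S m)).
Proof.
  symmetry; apply Clim_eq.
  destruct row_bound as [SB [SB0 HSB]].
  (* [g M k] is row k of the triangle k + i < M. Truncated subtraction leaves the rows k >= M empty,
     so the finite triangle is also a full series in k. *)
  set (g := fun (M k : nat) => Cpartial (F k) (M - k)).
  assert (forall M, Cpartial (fun m => Cpartial (fun k => F k (m - k)%nat) (S m)) M
                    = Cpartial (g M) M) as E.
  { induction M as [|M IH]; [reflexivity|].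
    change (Cpartial (fun m => Cpartial (fun k => F k (m - k)%nat) (S m)) M
            + Cpartial (fun k => F k (M - k)%nat) (S M) = Cpartial (g (S M)) (S M)).
    rewrite IH.
    assert (Cpartial (g M) M = Cpartial (g M) (S M)) as ->.
    { simpl; unfold g at 3; rewrite Nat.sub_diag; simpl; ring. }
    rewrite <- Cpartial_add; apply Cpartial_ext; intros k Hk.
    unfold g. rewrite Nat.sub_succ_l by lia. reflexivity. }
  apply Ccv_ext with (fun M => Csum (g M)).
  - intro M; rewrite E; apply Clim_eq, (Ccv_unshift M).
    apply Ccv_ext with (fun _ => Cpartial (g M) M); [|apply Ccv_const].
    intro n; rewrite Nat.add_comm, Cpartial_split.
    rewrite (Cpartial_zero (fun n => g M (M + n)%nat)); [ring|].
    intros i _; unfold g; replace (M - (M + i))%nat with O by lia; reflexivity.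
  - apply Csum_Tannery with (fun n => SB * A n)%R.
    + apply summable_scal; assumption.
    + intros j n; apply HSB.
    + intro n; unfold g. apply (Ccv_unshift n).
      apply Ccv_ext with (Cpartial (F n)); [intro j; f_equal; lia|].
      apply Csum_cv, dominated_row.
Qed.

End DoubleSeries.

(** * q-shifted factorials *)

Lemma qpoch_S a q n : qpoch a q (S n) = qpoch a q n * (C1 - a * q ^ n).
Proof. reflexivity. Qed.

Lemma qpoch_add a q n m : qpoch a q (n + m) = qpoch a q n * qpoch (a * q ^ n) q m.
Proof.
  induction m as [|m IH]; [rewrite Nat.add_0_r; unfold qpoch; simpl; ring|].
  rewrite Nat.add_succ_r, !qpoch_S, IH, Cpow_add; ring.
Qed.

Lemma qpoch_recl a q n : qpoch a q (S n) = (C1 - a) * qpoch (a * q) q n.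
Proof.
  change (S n) with (1 + n)%nat. rewrite qpoch_add.
  replace (a * q ^ 1) with (a * q) by (simpl; ring). unfold qpoch; simpl; ring.
Qed.

Lemma qpoch_0l q n : qpoch C0 q n = C1.
Proof. induction n as [|n IH]; [reflexivity|]. rewrite qpoch_S, IH; ring. Qed.

Section QPoch.

Variable q : CC.
Hypothesis q_gt0 : (0 < Cnorm q)%R.
Hypothesis q_lt1 : (Cnorm q < 1)%R.

Let qn := Cnorm q.

Lemma q_neq0 : q <> C0.
Proof. apply Cnorm_gt0_neq, q_gt0. Qed.

Lemma qpow_norm_le1 k : (Cnorm (q ^ k) <= 1)%R.
Proof.
  rewrite Cnorm_pow. replace 1%R with (1 ^ k)%R by apply pow1.
  apply pow_incr; lra.
Qed.

Lemma mul_qpow_norm_le x k : (Cnorm (x * q ^ k) <= Cnorm x)%R.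
Proof.
  rewrite Cnorm_mul. pose proof (qpow_norm_le1 k). pose proof (Cnorm_ge0 x). nra.
Qed.

Lemma mul_qpow_norm_lt1 x k : (Cnorm x < 1)%R -> (Cnorm (x * q ^ k) < 1)%R.
Proof. intro H; eapply Rle_lt_trans; [apply mul_qpow_norm_le|exact H]. Qed.

(** By 1 + x <= exp x the product is at most the exponential of a geometric sum. The bound does not
    depend on n and so survives in infinite products. *)
Lemma Cprod_norm_le f c : (0 <= c)%R -> (forall k, (Cnorm (f k) <= 1 + c * qn ^ k)%R) ->
  forall n, (Cnorm (Cprod f n) <= exp (c / (1 - qn)))%R.
Proof.
  intros Hc Hf n.
  apply Rle_trans with (exp (c * ((1 - qn ^ n) / (1 - qn)))).
  - induction n as [|n IH].
    + simpl; rewrite Cnorm_C1. unfold Rdiv; rewrite Rminus_diag, Rmult_0_l, Rmult_0_r, exp_0. lra.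
    + simpl Cprod; rewrite Cnorm_mul.
      replace (c * ((1 - qn ^ S n) / (1 - qn)))%R
        with (c * ((1 - qn ^ n) / (1 - qn)) + c * qn ^ n)%R
        by (simpl; field; unfold qn; lra).
      rewrite exp_plus.
      apply Rmult_le_compat; try apply Cnorm_ge0; [exact IH|].
      eapply Rle_trans; [apply Hf|apply exp_ineq1_le].
  - assert (c * ((1 - qn ^ n) / (1 - qn)) <= c / (1 - qn))%R as L.
    { unfold Rdiv; apply Rmult_le_compat_l; [exact Hc|].
      rewrite <- (Rmult_1_l (/ (1 - qn))) at 2.
      apply Rmult_le_compat_r; [left; apply Rinv_0_lt_compat; unfold qn; lra|].
      assert (0 <= qn ^ n)%R by (apply pow_le; unfold qn; lra). lra. }
    destruct L as [L|L]; [left; apply exp_increasing, L|rewrite L; lra].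
Qed.

Lemma qpoch_bounded rho : (0 <= rho)%R -> exists M, (0 < M)%R /\
  forall x n, (Cnorm x <= rho)%R -> (Cnorm (qpoch x q n) <= M)%R.
Proof.
  intros Hr; exists (exp (rho / (1 - qn))); split; [apply exp_pos|].
  intros x n Hx; apply Cprod_norm_le; [exact Hr|]. intro k.
  eapply Rle_trans; [apply Cnorm_sub|]. rewrite Cnorm_C1, Cnorm_mul, Cnorm_pow.
  fold qn. assert (0 <= qn ^ k)%R by (apply pow_le; unfold qn; lra). nra.
Qed.

Lemma qpoch_neq0 x n : (Cnorm x < 1)%R -> qpoch x q n <> C0.
Proof.
  intros Hx; induction n as [|n IH]; [intro H; injection H; lra|].
  rewrite qpoch_S; apply Cmul_neq0; [exact IH|].
  apply one_sub_neq0, mul_qpow_norm_lt1, Hx.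
Qed.

Lemma Cprod_inv f n : (forall k, f k <> C0) ->
  Cprod (fun k => Cinv (f k)) n = Cinv (Cprod f n).
Proof.
  intros Hf.
  assert (forall k, Cprod f k <> C0) as HP.
  { induction k as [|k IH]; [intro H; injection H; lra|]. apply Cmul_neq0; auto. }
  induction n as [|n IH]; simpl; [field; intro H; injection H; lra|].
  rewrite IH; field; auto.
Qed.

Lemma qpoch_inv_bounded rho : (0 <= rho < 1)%R -> exists M, (0 < M)%R /\
  forall x n, (Cnorm x <= rho)%R -> (Cnorm (Cinv (qpoch x q n)) <= M)%R.
Proof.
  (* The constant comes from 1/(1 - rho t) <= 1 + rho/(1 - rho) t on [0,1], the chord of a convex
     function, used at t = |q|^k. *)
  intros Hr; exists (exp (rho / (1 - rho) / (1 - qn))); split; [apply exp_pos|].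
  intros x n Hx.
  assert (forall k, C1 - x * q ^ k <> C0) as NZ
    by (intro k; apply one_sub_neq0, mul_qpow_norm_lt1; lra).
  unfold qpoch; rewrite <- Cprod_inv by exact NZ.
  apply Cprod_norm_le.
  { apply Rmult_le_pos; [lra|left; apply Rinv_0_lt_compat; lra]. }
  intro k. rewrite Cnorm_inv by apply NZ.
  assert (0 <= qn ^ k <= 1)%R as Q.
  { unfold qn; rewrite <- Cnorm_pow; split; [apply Cnorm_ge0|apply qpow_norm_le1]. }
  set (t := (qn ^ k)%R) in *.
  assert (1 - rho * t <= Cnorm (C1 - x * q ^ k))%R as L.
  { pose proof (Cnorm_add (C1 - x * q ^ k) (x * q ^ k)) as T.
    replace (C1 - x * q ^ k + x * q ^ k) with C1 in T by ring.
    rewrite Cnorm_C1, (Cnorm_mul x), Cnorm_pow in T. fold qn in T. fold t in T. nra. }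
  assert (0 < 1 - rho * t)%R by nra.
  apply Rle_trans with (/ (1 - rho * t))%R; [apply Rinv_le_contravar; assumption|].
  apply Rmult_le_reg_r with (1 - rho * t)%R; [assumption|]. rewrite Rinv_l by lra.
  apply Rmult_le_reg_r with (1 - rho)%R; [lra|].
  replace ((1 + rho / (1 - rho) * t) * (1 - rho * t) * (1 - rho))%R
    with ((1 - rho + rho * t) * (1 - rho * t))%R by (field; lra).
  replace ((1 - rho + rho * t) * (1 - rho * t))%R
    with (1 - rho + rho * rho * t * (1 - t))%R by ring.
  assert (0 <= rho * rho * t * (1 - t))%R by (repeat apply Rmult_le_pos; lra). lra.
Qed.

Lemma qpoch_inf_cv a : Ccv (qpoch a q) (qpoch_inf a q).
Proof.
  destruct (qpoch_bounded (Cnorm a) (Cnorm_ge0 a)) as [M [M0 HM]].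
  assert (dominated (fun n => qpoch a q (S n) - qpoch a q n)) as D.
  { apply dominated_geom with (M * Cnorm a)%R q; [exact q_lt1|]. intro n.
    rewrite qpoch_S.
    replace (qpoch a q n * (C1 - a * q ^ n) - qpoch a q n)
      with (Copp (qpoch a q n * (a * q ^ n))) by ring.
    rewrite Cnorm_opp, !Cnorm_mul, Cnorm_pow, <- Rmult_assoc.
    apply Rmult_le_compat_r; [apply pow_le, Cnorm_ge0|].
    apply Rmult_le_compat_r; [apply Cnorm_ge0|apply HM; lra]. }
  assert (Ccv (qpoch a q) (Csum (fun n => qpoch a q (S n) - qpoch a q n) + C1)) as H.
  { apply Ccv_ext with (fun n => Cpartial (fun n => qpoch a q (S n) - qpoch a q n) n + C1).
    - intro n; rewrite Cpartial_telescope; unfold qpoch at 2; simpl; ring.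
    - apply Ccv_add; [apply Csum_cv, D|apply Ccv_const]. }
  unfold qpoch_inf; rewrite (Clim_eq _ _ H); exact H.
Qed.

Lemma qpoch_inf_split a n : qpoch_inf a q = qpoch a q n * qpoch_inf (a * q ^ n) q.
Proof.
  apply Ccv_unique with (fun m => qpoch a q (m + n)).
  - apply Ccv_shift, qpoch_inf_cv.
  - apply Ccv_ext with (fun m => qpoch a q n * qpoch (a * q ^ n) q m).
    + intro m; rewrite Nat.add_comm, qpoch_add; reflexivity.
    + apply Ccv_scal, qpoch_inf_cv.
Qed.

Lemma qpoch_inf_recl a : qpoch_inf a q = (C1 - a) * qpoch_inf (a * q) q.
Proof.
  rewrite (qpoch_inf_split a 1).
  replace (a * q ^ 1) with (a * q) by (simpl; ring). unfold qpoch; simpl; ring.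
Qed.

Lemma qpoch_inf_0 : qpoch_inf C0 q = C1.
Proof.
  apply Clim_eq, Ccv_ext with (fun _ => C1); [|apply Ccv_const].
  intro n; symmetry; apply qpoch_0l.
Qed.

(** The inverses of the finite products are uniformly bounded, so the products stay away from 0 in
    the limit. *)
Lemma qpoch_inf_neq0 a : (Cnorm a < 1)%R -> qpoch_inf a q <> C0.
Proof.
  intros Ha. pose proof (Cnorm_ge0 a).
  destruct (qpoch_inv_bounded (Cnorm a)) as [M [M0 HM]]; [lra|].
  apply Cnorm_gt0_neq, Rlt_le_trans with (/ M)%R; [apply Rinv_0_lt_compat, M0|].
  apply Ccv_norm_ge with (qpoch a q); [apply qpoch_inf_cv|]. intro n.
  pose proof (qpoch_neq0 a n Ha) as NZ. specialize (HM a n (Rle_refl _)).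
  rewrite Cnorm_inv in HM by exact NZ. pose proof (Cnorm_gt0 _ NZ).
  rewrite <- (Rinv_inv (Cnorm (qpoch a q n))).
  apply Rinv_le_contravar; [apply Rinv_0_lt_compat; assumption|exact HM].
Qed.

Lemma qpoch_inf_bounded rho : (0 <= rho)%R -> exists M, (0 < M)%R /\
  forall x, (Cnorm x <= rho)%R -> (Cnorm (qpoch_inf x q) <= M)%R.
Proof.
  intros Hr; destruct (qpoch_bounded rho Hr) as [M [M0 HM]]; exists M; split; [exact M0|].
  intros x Hx; apply Ccv_norm_le with (qpoch x q); [apply qpoch_inf_cv|auto].
Qed.

Lemma Ccv_mul_qpow0 x : Ccv (fun j => x * q ^ j) C0.
Proof.
  replace C0 with (x * C0) by ring. apply Ccv_scal, Ccv_pow0, q_lt1.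
Qed.

Lemma qpoch_cv0 x n : Ccv (fun j => qpoch (x * q ^ j) q n) C1.
Proof.
  induction n as [|n IH]; [apply (Ccv_const C1)|].
  replace C1 with (C1 * (C1 + (Copp (q ^ n)) * C0)) by ring.
  apply Ccv_ext with (fun j => qpoch (x * q ^ j) q n * (C1 + (Copp (q ^ n)) * (x * q ^ j))).
  - intro j; rewrite qpoch_S; ring.
  - apply Ccv_mul; [exact IH|].
    apply Ccv_add; [apply Ccv_const|apply Ccv_scal, Ccv_mul_qpow0].
Qed.

Lemma qpoch_qq_neq0 n : qpoch q q n <> C0.
Proof. apply qpoch_neq0, q_lt1. Qed.

(* Iterating (1 - z) f(z) = (1 - Az) f(qz) towards f(0) = 1. *)
Lemma q_binomial A z : (Cnorm z < 1)%R ->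
  Csum (fun n => qpoch A q n / qpoch q q n * z ^ n) = qpoch_inf (A * z) q / qpoch_inf z q.
Proof.
  destruct (qpoch_bounded (Cnorm A) (Cnorm_ge0 A)) as [M [M0 HM]].
  destruct (qpoch_inv_bounded (Cnorm q)) as [M' [M'0 HM']]; [lra|].
  set (f := fun z => Csum (fun n => qpoch A q n / qpoch q q n * z ^ n)).
  assert (forall z n, (Cnorm (qpoch A q n / qpoch q q n * z ^ n) <= M * M' * Cnorm z ^ n)%R) as B.
  { intros w n; unfold Cdiv; rewrite !Cnorm_mul, Cnorm_pow.
    apply Rmult_le_compat_r; [apply pow_le, Cnorm_ge0|].
    apply Rmult_le_compat; try apply Cnorm_ge0; [apply HM|apply HM']; lra. }
  assert (forall z, (Cnorm z < 1)%R -> dominated (fun n => qpoch A q n / qpoch q q n * z ^ n)) as D.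
  { intros w Hw; apply dominated_geom with (M * M')%R w; auto. }
  assert (forall z, (Cnorm z < 1)%R -> (C1 - z) * f z = (C1 - A * z) * f (z * q)) as FE.
  { intros w Hw.
    assert (Cnorm (w * q) < 1)%R as Hwq.
    { replace (w * q) with (w * q ^ 1) by (simpl; ring). apply mul_qpow_norm_lt1, Hw. }
    set (t := fun n => qpoch A q n / qpoch q q n * w ^ n).
    set (t' := fun n => qpoch A q n / qpoch q q n * (w * q) ^ n).
    assert ((C1 - w) * Csum t + Copp (C1 - A * w) * Csum t'
            = C0 - Copp ((C1 - q ^ 0) * t O)) as E.
    (* The certificate -(1 - q^n) t_n vanishes at n = 0, which makes this functional equation
       homogeneous. *)
    { apply (Csum_telescope2 t t' (C1 - w) (Copp (C1 - A * w))
        (fun n => Copp ((C1 - q ^ n) * t n))).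
      - apply D, Hw.
      - apply D, Hwq.
      - intro n; unfold t, t'. rewrite !qpoch_S, Cpow_mul_base. simpl Cpow.
        field; split; [apply qpoch_qq_neq0|].
        apply (one_sub_neq0 (q * q ^ n)), mul_qpow_norm_lt1, q_lt1.
      - apply Ccv_geom with (2 * (M * M'))%R w; [exact Hw|]. intro n.
        rewrite Cnorm_opp, Cnorm_mul, Rmult_assoc.
        apply Rmult_le_compat; try apply Cnorm_ge0; [|apply B].
        eapply Rle_trans; [apply Cnorm_sub|]. rewrite Cnorm_C1.
        pose proof (qpow_norm_le1 n); lra. }
    change (f w) with (Csum t); change (f (w * q)) with (Csum t').
    transitivity ((C1 - w) * Csum t + Copp (C1 - A * w) * Csum t' + (C1 - A * w) * Csum t');
      [ring|rewrite E; simpl; ring]. }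
  intro Hz. change (f z = qpoch_inf (A * z) q / qpoch_inf z q).
  assert (forall j, qpoch z q j * f z = qpoch (A * z) q j * f (z * q ^ j)) as IT.
  { induction j as [|j IH].
    - simpl. replace (z * C1) with z by ring. reflexivity.
    - rewrite !qpoch_S.
      replace (qpoch z q j * (C1 - z * q ^ j) * f z)
        with ((C1 - z * q ^ j) * (qpoch z q j * f z)) by ring.
      rewrite IH.
      replace ((C1 - z * q ^ j) * (qpoch (A * z) q j * f (z * q ^ j)))
        with (qpoch (A * z) q j * ((C1 - z * q ^ j) * f (z * q ^ j))) by ring.
      rewrite FE by (apply mul_qpow_norm_lt1, Hz).
      replace (z * q ^ j * q) with (z * q ^ S j) by (simpl; ring). ring. }
  (* Every term with n > 0 contains a positive power of z q^j, so only the term of index 0 survives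
     in the limit. *)
  assert (Ccv (fun j => f (z * q ^ j)) C1) as L.
  { replace C1 with (Csum (fun n => match n with O => C1 | _ => C0 end)).
    - apply Csum_Tannery with (fun n => M * M' * Cnorm z ^ n)%R.
      + apply summable_scal; [nra|]. apply summable_geom; split; [apply Cnorm_ge0|exact Hz].
      + intros j n; eapply Rle_trans; [apply B|].
        apply Rmult_le_compat_l; [nra|]. apply pow_incr; split; [apply Cnorm_ge0|].
        apply mul_qpow_norm_le.
      + intros [|n].
        * apply Ccv_ext with (fun _ => C1); [|apply Ccv_const].
          intro; unfold qpoch; simpl; field. intro H; injection H; lra.
        * set (c := qpoch A q (S n) / qpoch q q (S n)).
          replace C0 with (c * C0 ^ S n) by (simpl; ring).
          apply Ccv_scal, Ccv_pow, Ccv_mul_qpow0.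
    - apply Csum_single; reflexivity. }
  assert (qpoch_inf z q * f z = qpoch_inf (A * z) q) as E.
  { apply Ccv_unique with (fun j => qpoch z q j * f z).
    - apply Ccv_mul; [apply qpoch_inf_cv|apply Ccv_const].
    - apply Ccv_ext with (fun j => qpoch (A * z) q j * f (z * q ^ j)); [intro; symmetry; apply IT|].
      replace (qpoch_inf (A * z) q) with (qpoch_inf (A * z) q * C1) by ring.
      apply Ccv_mul; [apply qpoch_inf_cv|exact L]. }
  rewrite <- E; field. apply qpoch_inf_neq0, Hz.
Qed.

End QPoch.

(** * Symmetry of the convolution coefficients *)

(* The homogenized Gaussian binomial [n choose k]_q v^(n-k), equal to 0 for k > n. *)
Fixpoint gauss (q v : CC) (n k : nat) : CC :=
  match n, k with
  | _, O => v ^ n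
  | O, S _ => C0
  | S m, S j => v * q ^ k * gauss q v m k + gauss q v m j
  end.

Section Gauss.

Variable q : CC.

Lemma gauss_n0 v n : gauss q v n 0 = v ^ n.
Proof. destruct n; reflexivity. Qed.

Lemma gauss_SS v n k :
  gauss q v (S n) (S k) = v * q ^ S k * gauss q v n (S k) + gauss q v n k.
Proof. reflexivity. Qed.

Lemma gauss_gt v n k : (n < k)%nat -> gauss q v n k = C0.
Proof.
  revert k; induction n as [|n IH]; intros [|k] H; try lia; [reflexivity|].
  rewrite gauss_SS, !IH by lia; ring.
Qed.

(** Homogeneity of degree n - k in [v], multiplied by q^k so that no exponent n - k appears and k >
    n needs no separate treatment. *)
Lemma gauss_scale v n k : q ^ k * gauss q (q * v) n k = q ^ n * gauss q v n k.
Proof.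
  revert k; induction n as [|n IH]; intros [|k].
  - reflexivity.
  - simpl; ring.
  - rewrite !gauss_n0, Cpow_mul_base; simpl; ring.
  - rewrite !gauss_SS.
    transitivity (q * q * v * q ^ k * (q ^ S k * gauss q (q * v) n (S k))
                  + q * (q ^ k * gauss q (q * v) n k)); [simpl; ring|].
    rewrite !IH; simpl; ring.
Qed.

(** The other q-Pascal rule; its factor q^(n-k) is absorbed by the replacement of [v] by [q * v]. *)
Lemma gauss_SS' v n k :
  gauss q v (S n) (S k) = v * gauss q v n (S k) + gauss q (q * v) n k.
Proof.
  revert k; induction n as [|n IH]; intros k.
  - destruct k; simpl; ring.
  - rewrite (gauss_SS v (S n)). destruct k as [|k].
    + rewrite (IH 0%nat) at 1. rewrite (gauss_SS v n 0), !gauss_n0.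
      rewrite Cpow_mul_base; simpl Cpow.
      pose proof (gauss_scale v n 0) as E; rewrite !gauss_n0 in E; simpl in E.
      pose proof (IH 0%nat) as E'. rewrite gauss_SS, !gauss_n0 in E'.
      rewrite Cpow_mul_base in *. simpl Cpow in *.
      transitivity (v * q * (v * gauss q v n 1 + q ^ n * v ^ n) + v * v ^ n); [ring|].
      transitivity (v * (v * (q * C1) * gauss q v n 1 + v ^ n) + q * v * (q ^ n * v ^ n)); ring.
    + rewrite (IH (S k)), (IH k) at 1.
      rewrite (gauss_SS (q * v) n k), (gauss_SS v n (S k)).
      simpl Cpow; ring.
Qed.

(** The quotient formula for q-binomials cleared of denominators, which makes it a polynomial
    identity provable by the Pascal recursion. *)
Lemma gauss_closed v k i : gauss q v (k + i) k * (qpoch q q k * qpoch q q i)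
  = qpoch q q (k + i) * v ^ i.
Proof.
  remember (k + i)%nat as n eqn:E. revert k i E.
  induction n as [|n IH]; intros [|k] i E; try (simpl in E; lia).
  - simpl in E; subst i; unfold qpoch; simpl; ring.
  - simpl in E; subst i; rewrite gauss_n0; unfold qpoch at 1; simpl Cprod; ring.
  - destruct i as [|i].
    + rewrite Nat.add_0_r in E; rewrite <- E, gauss_SS, gauss_gt by lia.
      specialize (IH n 0%nat ltac:(lia)).
      assert (k = n) as -> by lia.
      transitivity ((C1 - q * q ^ n) * (gauss q v n n * (qpoch q q n * qpoch q q 0)));
        [rewrite (qpoch_S q q n); ring|].
      rewrite IH, (qpoch_S q q n); ring.
    + rewrite gauss_SS.
      pose proof (IH (S k) i ltac:(lia)) as H1.
      pose proof (IH k (S i) ltac:(lia)) as H2.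
      assert (n = k + S i)%nat as -> by lia.
      transitivity (v * q ^ S k * (C1 - q * q ^ i) *
          (gauss q v (k + S i) (S k) * (qpoch q q (S k) * qpoch q q i))
        + (C1 - q * q ^ k) * (gauss q v (k + S i) k * (qpoch q q k * qpoch q q (S i)))).
      { rewrite !qpoch_S; ring. }
      rewrite H1, H2, (qpoch_S q q (k + S i)), !Cpow_add. simpl Cpow. ring.
Qed.

Lemma gauss_absorb v n k : (forall m, C1 - q * q ^ m <> C0) ->
  (C1 - q ^ S k) * gauss q v (S n) (S k) = (C1 - q ^ S n) * gauss q v n k.
Proof.
  intros NZ.
  assert (forall m, qpoch q q m <> C0) as NP.
  { induction m as [|m IH]; [intro H; injection H; lra|].
    rewrite qpoch_S; apply Cmul_neq0; auto. }
  destruct (le_lt_dec k n) as [L|L]; [|rewrite !gauss_gt by lia; ring].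
  pose proof (gauss_closed v (S k) (n - k)) as H1.
  pose proof (gauss_closed v k (n - k)) as H2.
  replace (S k + (n - k))%nat with (S n) in H1 by lia.
  replace (k + (n - k))%nat with n in H2 by lia.
  assert (gauss q v (S n) (S k) = qpoch q q (S n) * v ^ (n - k)
            / (qpoch q q (S k) * qpoch q q (n - k))) as ->
    by (rewrite <- H1; field; auto).
  assert (gauss q v n k = qpoch q q n * v ^ (n - k)
            / (qpoch q q k * qpoch q q (n - k))) as ->
    by (rewrite <- H2; field; auto).
  rewrite !qpoch_S; simpl Cpow; field; auto.
Qed.

End Gauss.

(** * The convolutions [D_n] and their recurrence *)

Definition wcoef (q a d u v : CC) (k : nat) : CC :=
  qpoch (a * v) q k * qpoch (d * v) q k / qpoch (a * d * u * v) q k * u ^ k.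

Definition conv (q a d u v : CC) (T : nat -> CC) (n : nat) : CC :=
  Cpartial (fun k => gauss q v n k * wcoef q a d u v k * T k) (S n).

Lemma Cpartial_extend f N M : (N <= M)%nat -> (forall n, (N <= n)%nat -> f n = C0) ->
  Cpartial f M = Cpartial f N.
Proof.
  intros L H; replace M with (N + (M - N))%nat by lia.
  rewrite Cpartial_split, (Cpartial_zero (fun n => f (N + n)%nat)); [ring|].
  intros; apply H; lia.
Qed.

Lemma conv_extend q a d u v T n M : (n < M)%nat ->
  conv q a d u v T n = Cpartial (fun k => gauss q v n k * wcoef q a d u v k * T k) M.
Proof.
  intros L; symmetry; apply Cpartial_extend; [exact L|].
  intros k Hk; rewrite gauss_gt by lia; ring.
Qed.

Lemma Abel_summation G T M :
  Cpartial (fun k => (G k - G (S k)) * T k) M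
  = G O * T O + Cpartial (fun k => G (S k) * (T (S k) - T k)) M - G M * T M.
Proof. induction M as [|M IH]; simpl; [|rewrite IH]; ring. Qed.

Section Conv.

Variables q a d u v : CC.
Hypothesis q_gt0 : (0 < Cnorm q)%R.
Hypothesis q_lt1 : (Cnorm q < 1)%R.
Hypothesis aduv_lt1 : (Cnorm (a * d * u * v) < 1)%R.

Let w := wcoef q a d u v.

(** A certificate of creative telescoping in k, with value 0 at k = 0 to avoid a lower boundary
    term. By the ratio of consecutive weights, its value at j+1 is also
    [gauss q (q * v) n j * w (S j)] times 1 - a d u v q^j. *)
Definition conv_cert (n k : nat) : CC :=
  match k with
  | O => C0
  | S j => gauss q (q * v) n j * w j * (C1 - a * v * q ^ j) * (C1 - d * v * q ^ j) * u
  end.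

Lemma aduv_factor_neq0 k : C1 - a * d * u * v * q ^ k <> C0.
Proof. apply one_sub_neq0, mul_qpow_norm_lt1; assumption. Qed.

Lemma conv_cert_spec n k :
  (C1 - a * d * u * v * q ^ n) * (gauss q v (S n) k * w k)
  - (u + v - (a + d) * u * v * q ^ n) * (gauss q v n k * w k)
  + u * v * (C1 - q ^ n) * (gauss q v (pred n) k * w k)
  = conv_cert n k - conv_cert n (S k).
Proof.
  assert (forall m, C1 - q * q ^ m <> C0) as NZ
    by (intro; apply one_sub_neq0, mul_qpow_norm_lt1; assumption).
  (* The left side carries the factor 1 - q^(n-k), which lowers n by absorption. This trades the
     index n - 1 for a scaling of [v]; at n = 0 both sides vanish, so [pred 0 = 0] does no harm. *)
  assert (gauss q v n k - gauss q (q * v) n k = v * (C1 - q ^ n) * gauss q v (pred n) k) as II.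
  { destruct n as [|m].
    - destruct k; simpl; ring.
    - simpl pred. pose proof (gauss_SS' q v (S m) k) as P.
      rewrite (gauss_SS q v (S m) k) in P.
      pose proof (gauss_absorb q v m k NZ) as A.
      transitivity (v * ((C1 - q ^ S k) * gauss q v (S m) (S k))); [|rewrite A; ring].
      transitivity (gauss q v (S m) k - (v * gauss q v (S m) (S k) + gauss q (q * v) (S m) k)
                    + v * gauss q v (S m) (S k)); [ring|].
      rewrite <- P; ring. }
  pose proof (gauss_scale q v n k) as I.
  transitivity ((C1 - a * d * u * v * q ^ n) * (gauss q v (S n) k * w k)
    - (u + v - (a + d) * u * v * q ^ n) * (gauss q v n k * w k)
    + u * (v * (C1 - q ^ n) * gauss q v (pred n) k) * w k); [ring|].
  rewrite <- II.
  destruct k as [|k]; unfold conv_cert.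
  - rewrite !gauss_n0 in *. simpl Cpow in *.
    transitivity ((Copp u * v ^ n - a * d * u * v * v * (q ^ n * v ^ n)
       + (a + d) * u * v * (q ^ n * v ^ n) + u * v ^ n - u * (q * v) ^ n) * w 0%nat); [ring|].
    rewrite <- I; ring.
  - assert (w (S k) = w k * (C1 - a * v * q ^ k) * (C1 - d * v * q ^ k) * u
             / (C1 - a * d * u * v * q ^ k)) as Ew.
    { unfold w, wcoef. rewrite !qpoch_S; simpl Cpow; field; split.
      - apply qpoch_neq0; assumption.
      - apply (aduv_factor_neq0 k). }
    assert (w k * (C1 - a * v * q ^ k) * (C1 - d * v * q ^ k) * u
      = w (S k) * (C1 - a * d * u * v * q ^ k)) as Ew'
      by (rewrite Ew; field; apply (aduv_factor_neq0 k)).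
    pose proof (gauss_scale q v n (S k)) as I1.
    pose proof (gauss_scale q v n k) as I0.
    transitivity (gauss q (q * v) n k *
        (w k * (C1 - a * v * q ^ k) * (C1 - d * v * q ^ k) * u)
      - gauss q (q * v) n (S k) * w (S k) * (C1 - a * v * q ^ S k) * (C1 - d * v * q ^ S k) * u);
      [rewrite Ew'|ring].
    set (J0 := gauss q (q * v) n k) in *. set (J1 := gauss q (q * v) n (S k)) in *.
    set (H1 := gauss q v n (S k)) in *. set (H0 := gauss q v n k) in *.
    pose proof (gauss_SS q v n k) as P1. fold H0 H1 in P1.
    pose proof (gauss_SS' q v n k) as P2. fold H1 J0 in P2.
    transitivity (w (S k) * (gauss q v (S n) (S k)
       - a * d * u * v * (q ^ n * gauss q v (S n) (S k))
       - (u + v) * H1 + (a + d) * u * v * (q ^ n * H1) + u * (H1 - J1))); [ring|].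
    (* The copy multiplied by q^n is expanded by the first Pascal rule, so that [gauss_scale] can
       absorb q^n; the other copy by the second rule. Only [H1], [J0] and [J1] remain. *)
    rewrite P1 at 2. rewrite P2.
    replace (q ^ n * (v * q ^ S k * H1 + H0))
      with (v * q ^ S k * (q ^ n * H1) + q ^ n * H0) by ring.
    rewrite <- I1, <- I0. simpl Cpow. ring.
Qed.

(** Summation by parts on the certificate: [T] survives only through its increments, so a constant
    [T] gives a homogeneous recurrence. *)
Lemma conv_rec T n :
  (C1 - a * d * u * v * q ^ n) * conv q a d u v T (S n)
  - (u + v - (a + d) * u * v * q ^ n) * conv q a d u v T n
  + u * v * (C1 - q ^ n) * conv q a d u v T (pred n)
  = Cpartial (fun k => conv_cert n (S k) * (T (S k) - T k)) (S n).
Proof.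
  rewrite (conv_extend q a d u v T (S n) (S (S n))), (conv_extend q a d u v T n (S (S n))),
    (conv_extend q a d u v T (pred n) (S (S n))) by lia.
  fold w. set (M := S (S n)).
  transitivity (Cpartial (fun k => (conv_cert n k - conv_cert n (S k)) * T k) M).
  - rewrite <- !Cpartial_scal.
    transitivity (Cpartial (fun k =>
       (C1 - a * d * u * v * q ^ n) * (gauss q v (S n) k * w k * T k)
       + (Copp (u + v - (a + d) * u * v * q ^ n)) * (gauss q v n k * w k * T k)
       + u * v * (C1 - q ^ n) * (gauss q v (pred n) k * w k * T k)) M).
    + rewrite !Cpartial_add, !Cpartial_scal; ring.
    + apply Cpartial_ext; intros k _; rewrite <- conv_cert_spec; ring.
  - assert (forall k, (n < k)%nat -> conv_cert n (S k) = C0) as Z.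
    { intros k Hk; simpl; rewrite gauss_gt by exact Hk; ring. }
    rewrite Abel_summation. unfold M at 2 3.
    rewrite (Cpartial_extend (fun k => conv_cert n (S k) * (T (S k) - T k)) (S n) M).
    + rewrite Z by lia. simpl conv_cert at 1. ring.
    + unfold M; lia.
    + intros k Hk; rewrite Z by lia; ring.
Qed.

End Conv.

(* The product form of (q/(cu);q)_k (cv)^k, defined also for c = 0. *)
Definition hpoch (q c u v : CC) (k : nat) : CC :=
  Cprod (fun j => c * v - q ^ S j * v / u) k.

Definition rterm (q a c d u v : CC) (n : nat) : CC :=
  hpoch q c u v n * qpoch (a * d * u * v) q n
  / (qpoch (a * v) q (S n) * qpoch (d * v) q (S n)).

(** At n = 0 the recurrence involves only the indices 0 and 1, because [pred 0 = 0]; hence one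
    initial value determines a solution of this second-order recurrence. *)
Lemma conv_unique (al be ga rhs X Y : nat -> CC) : (forall n, al n <> C0) ->
  (forall n, al n * X (S n) - be n * X n + ga n * X (pred n) = rhs n) ->
  (forall n, al n * Y (S n) - be n * Y n + ga n * Y (pred n) = rhs n) ->
  X O = Y O -> forall n, X n = Y n.
Proof.
  intros NZ HX HY H0 n.
  assert (forall n, X n = Y n /\ X (pred n) = Y (pred n)) as A; [|apply A].
  clear n; induction n as [|n [IH IH']]; [auto|]. split; [|exact IH].
  specialize (HX n); specialize (HY n); specialize (NZ n).
  assert (forall Z, Z (S n) = (al n * Z (S n) - be n * Z n + ga n * Z (pred n)
     + be n * Z n - ga n * Z (pred n)) / al n) as E by (intro; field; exact NZ).
  rewrite (E X), (E Y), HX, HY, IH, IH'. reflexivity.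
Qed.

Section ConvSym.

Variables q a d u v : CC.
Hypothesis q_gt0 : (0 < Cnorm q)%R.
Hypothesis q_lt1 : (Cnorm q < 1)%R.
Hypothesis aduv_lt1 : (Cnorm (a * d * u * v) < 1)%R.

Lemma advu_lt1 : (Cnorm (a * d * v * u) < 1)%R.
Proof. replace (a * d * v * u) with (a * d * u * v) by ring; exact aduv_lt1. Qed.

Lemma conv1_sym n : conv q a d u v (fun _ => C1) n = conv q a d v u (fun _ => C1) n.
Proof.
  revert n; apply (conv_unique (fun n => C1 - a * d * u * v * q ^ n)
    (fun n => u + v - (a + d) * u * v * q ^ n) (fun n => u * v * (C1 - q ^ n)) (fun _ => C0)).
  - intro; apply aduv_factor_neq0; assumption.
  - intro n; rewrite conv_rec by assumption. apply Cpartial_zero; intros; ring.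
  - intro n. pose proof (conv_rec q a d v u q_gt0 q_lt1 advu_lt1 (fun _ => C1) n) as E.
    rewrite (Cpartial_zero (fun k => conv_cert q a d v u n (S k) * (C1 - C1))) in E
      by (intros; ring).
    rewrite <- E; ring.
  - unfold conv, wcoef, qpoch; simpl; ring.
Qed.

End ConvSym.

Section ConvTail.

Variables q a c d u v : CC.
Hypothesis q_gt0 : (0 < Cnorm q)%R.
Hypothesis q_lt1 : (Cnorm q < 1)%R.
Hypothesis u_neq0 : u <> C0.
Hypothesis aduv_lt1 : (Cnorm (a * d * u * v) < 1)%R.
Hypothesis av_lt1 : (Cnorm (a * v) < 1)%R.
Hypothesis dv_lt1 : (Cnorm (d * v) < 1)%R.

(** With x = cuv and y = qv, u^k [hpoch] is the product of x - y q^j over j < k. The identity is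
    thus Cauchy's expansion of x^n in these q-Newton products. *)
Lemma gauss_hpoch_sum n :
  Cpartial (fun k => gauss q (q * v) n k * (u ^ k * hpoch q c u v k)) (S n) = (c * u * v) ^ n.
Proof.
  induction n as [|n IH]; [unfold hpoch; simpl; ring|].
  set (P := fun k => u ^ k * hpoch q c u v k) in *.
  assert (forall k, P (S k) = P k * (c * u * v - v * q ^ S k)) as EP.
  { intro k; unfold P, hpoch; simpl; field; exact u_neq0. }
  rewrite Cpartial_recl.
  rewrite (Cpartial_ext _ (fun k => q * v * q ^ S k * gauss q (q * v) n (S k) * P (S k)
     + gauss q (q * v) n k * P (S k))).
  2:{ intros k _. rewrite gauss_SS; fold (P (S k)). ring. }
  rewrite Cpartial_add.
  (* One half of the Pascal rule, reindexed, multiplies the k-th term by v q^(k+1); the other half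
     multiplies it by cuv - v q^(k+1). Together they give the factor cuv. *)
  assert (gauss q (q * v) (S n) 0 * (u ^ 0 * hpoch q c u v 0)
    + Cpartial (fun k => q * v * q ^ S k * gauss q (q * v) n (S k) * P (S k)) (S n)
    = Cpartial (fun k => q * v * q ^ k * gauss q (q * v) n k * P k) (S n)) as E.
  { transitivity (Cpartial (fun k => q * v * q ^ k * gauss q (q * v) n k * P k) (S (S n))).
    - rewrite (Cpartial_recl _ (S n)). f_equal.
      rewrite !gauss_n0; unfold P; simpl; ring.
    - change (Cpartial (fun k => q * v * q ^ k * gauss q (q * v) n k * P k) (S n)
        + q * v * q ^ S n * gauss q (q * v) n (S n) * P (S n)
        = Cpartial (fun k => q * v * q ^ k * gauss q (q * v) n k * P k) (S n)).
      rewrite gauss_gt by lia; ring. }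
  transitivity (gauss q (q * v) (S n) 0 * (u ^ 0 * hpoch q c u v 0)
    + Cpartial (fun k => q * v * q ^ S k * gauss q (q * v) n (S k) * P (S k)) (S n)
    + Cpartial (fun k => gauss q (q * v) n k * P (S k)) (S n)); [ring|].
  rewrite E, <- Cpartial_add.
  rewrite (Cpartial_ext _ (fun k => c * u * v * (gauss q (q * v) n k * P k))).
  - rewrite Cpartial_scal. unfold P; rewrite IH; simpl; ring.
  - intros k _; rewrite EP; simpl; ring.
Qed.

(** The increment of the weight is [v * rterm k]. Its denominators cancel against the numerators of
    the certificate, and (aduv)_k against that of [wcoef]; what remains is uv times the sum in
    [gauss_hpoch_sum]. *)
Lemma conv_tail_rec n :
  (C1 - a * d * u * v * q ^ n) * conv q a d u v (fun k => v * Cpartial (rterm q a c d u v) k) (S n)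
  - (u + v - (a + d) * u * v * q ^ n)
    * conv q a d u v (fun k => v * Cpartial (rterm q a c d u v) k) n
  + u * v * (C1 - q ^ n)
    * conv q a d u v (fun k => v * Cpartial (rterm q a c d u v) k) (pred n)
  = u * v * (c * u * v) ^ n.
Proof.
  rewrite conv_rec, <- gauss_hpoch_sum, <- Cpartial_scal by assumption.
  apply Cpartial_ext; intros k _. simpl Cpartial. unfold conv_cert, wcoef, rterm.
  rewrite !qpoch_S. field.
  repeat split; try (apply qpoch_neq0; assumption);
    apply (one_sub_neq0 (_ * q ^ k)), mul_qpow_norm_lt1; assumption.
Qed.

End ConvTail.

Lemma conv_tail_sym q a c d u v n : (0 < Cnorm q)%R -> (Cnorm q < 1)%R ->
  u <> C0 -> v <> C0 -> (Cnorm (a * d * u * v) < 1)%R ->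
  (Cnorm (a * u) < 1)%R -> (Cnorm (a * v) < 1)%R ->
  (Cnorm (d * u) < 1)%R -> (Cnorm (d * v) < 1)%R ->
  conv q a d u v (fun k => v * Cpartial (rterm q a c d u v) k) n
  = conv q a d v u (fun k => u * Cpartial (rterm q a c d v u) k) n.
Proof.
  intros q0 q1 Hu Hv Had Hau Hav Hdu Hdv. revert n.
  apply (conv_unique (fun n => C1 - a * d * u * v * q ^ n)
    (fun n => u + v - (a + d) * u * v * q ^ n) (fun n => u * v * (C1 - q ^ n))
    (fun n => u * v * (c * u * v) ^ n)).
  - intro; apply aduv_factor_neq0; assumption.
  - intro; apply conv_tail_rec; assumption.
  - intro n.
    pose proof (conv_tail_rec q a c d v u q0 q1 Hv (advu_lt1 _ _ _ _ Had) Hau Hdu n) as E.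
    replace (c * v * u) with (c * u * v) in E by ring.
    replace (u * v * (c * u * v) ^ n) with (v * u * (c * u * v) ^ n) by ring.
    rewrite <- E; ring.
  - unfold conv; simpl; ring.
Qed.

(** * Series in convolution form *)

(** The product (A b v q^k)_oo stands in the numerator in place of 1/(A b v)_k, so that nothing has
    to be assumed about [A]. The factor 1/(bv)_oo is left out and reappears in [Csum_sterm]. *)
Definition sterm (q A a d b u v : CC) (T : nat -> CC) (k : nat) : CC :=
  qpoch A q k * qpoch_inf (A * (b * v) * q ^ k) q
  * (qpoch (a * v) q k * qpoch (d * v) q k / (qpoch q q k * qpoch (a * d * u * v) q k))
  * (b * u) ^ k * T k.

Section ConvSeries.

Variables (q A a d b u v : CC) (T : nat -> CC).
Hypothesis q_gt0 : (0 < Cnorm q)%R.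
Hypothesis q_lt1 : (Cnorm q < 1)%R.
Hypothesis aduv_lt1 : (Cnorm (a * d * u * v) < 1)%R.
Hypothesis bu_lt1 : (Cnorm (b * u) < 1)%R.
Hypothesis T_bounded : exists M, forall k, (Cnorm (T k) <= M)%R.

Lemma sterm_coef_bounded : exists M, (0 < M)%R /\ forall k,
  (Cnorm (qpoch (a * v) q k * qpoch (d * v) q k / (qpoch q q k * qpoch (a * d * u * v) q k) * T k)
   <= M)%R.
Proof.
  destruct T_bounded as [MT HT].
  destruct (qpoch_bounded q q_gt0 q_lt1 (Cnorm (a * v)) (Cnorm_ge0 _)) as [M1 [P1 H1]].
  destruct (qpoch_bounded q q_gt0 q_lt1 (Cnorm (d * v)) (Cnorm_ge0 _)) as [M2 [P2 H2]].
  destruct (qpoch_inv_bounded q q_gt0 q_lt1 (Cnorm q)) as [M3 [P3 H3]]; [lra|].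
  destruct (qpoch_inv_bounded q q_gt0 q_lt1 (Cnorm (a * d * u * v))) as [M4 [P4 H4]];
    [split; [apply Cnorm_ge0|assumption]|].
  assert (0 <= MT)%R by (eapply Rle_trans; [apply Cnorm_ge0|apply (HT O)]).
  exists (M1 * M2 * (M3 * M4) * (MT + 1))%R; split.
  { repeat apply Rmult_lt_0_compat; lra. }
  intro k.
  replace (qpoch (a * v) q k * qpoch (d * v) q k / (qpoch q q k * qpoch (a * d * u * v) q k) * T k)
    with (qpoch (a * v) q k * qpoch (d * v) q k
          * (Cinv (qpoch q q k) * Cinv (qpoch (a * d * u * v) q k)) * T k)
    by (field; split; apply qpoch_neq0; assumption).
  rewrite !Cnorm_mul.
  specialize (H1 _ k (Rle_refl _)); specialize (H2 _ k (Rle_refl _)).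
  specialize (H3 _ k (Rle_refl _)); specialize (H4 _ k (Rle_refl _)); specialize (HT k).
  repeat (apply Rmult_le_compat; repeat apply Rmult_le_pos; try apply Cnorm_ge0; try assumption).
  lra.
Qed.

Lemma sterm_dominated : dominated (sterm q A a d b u v T).
Proof.
  destruct sterm_coef_bounded as [M [M0 HM]].
  destruct (qpoch_bounded q q_gt0 q_lt1 (Cnorm A) (Cnorm_ge0 _)) as [M1 [P1 H1]].
  destruct (qpoch_inf_bounded q q_gt0 q_lt1 (Cnorm (A * (b * v))) (Cnorm_ge0 _)) as [M2 [P2 H2]].
  apply dominated_geom with (M1 * M2 * M)%R (b * u); [assumption|]. intro k.
  unfold sterm.
  set (X := qpoch (a * v) q k * qpoch (d * v) q k / (qpoch q q k * qpoch (a * d * u * v) q k)).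
  replace (qpoch A q k * qpoch_inf (A * (b * v) * q ^ k) q * X * (b * u) ^ k * T k)
    with (qpoch A q k * qpoch_inf (A * (b * v) * q ^ k) q * (X * T k) * (b * u) ^ k) by ring.
  specialize (HM k); fold X in HM.
  rewrite !(Cnorm_mul _ ((b * u) ^ k)), Cnorm_pow.
  apply Rmult_le_compat_r; [apply pow_le, Cnorm_ge0|].
  rewrite (Cnorm_mul _ (X * T k)), (Cnorm_mul (qpoch A q k)).
  repeat (apply Rmult_le_compat; repeat apply Rmult_le_pos; try apply Cnorm_ge0; try assumption).
  - apply H1; lra.
  - apply H2, mul_qpow_norm_le; assumption.
Qed.

(** Each term is expanded by the q-binomial theorem in powers of bv, which gives a double series in
    k and i. On the diagonal k + i = n, the factor 1/((q)_k (q)_i) becomes a Gaussian binomial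
    divided by (q)_n. *)
Lemma Csum_sterm : (Cnorm (b * v) < 1)%R ->
  Csum (sterm q A a d b u v T) = qpoch_inf (b * v) q *
  Csum (fun n => qpoch A q n / qpoch q q n * b ^ n * conv q a d u v T n).
Proof.
  intros bv_lt1.
  set (om := fun k => qpoch (a * v) q k * qpoch (d * v) q k
                      / (qpoch q q k * qpoch (a * d * u * v) q k) * T k).
  set (F := fun k i => qpoch A q (k + i) * (om k * (b * u) ^ k) * ((b * v) ^ i / qpoch q q i)).
  destruct sterm_coef_bounded as [M [M0 HM]].
  destruct (qpoch_bounded q q_gt0 q_lt1 (Cnorm A) (Cnorm_ge0 _)) as [M1 [P1 H1]].
  destruct (qpoch_inv_bounded q q_gt0 q_lt1 (Cnorm q)) as [M3 [P3 H3]]; [lra|].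
  assert (qpoch_inf (b * v) q <> C0) as NZ by (apply qpoch_inf_neq0; assumption).
  assert (forall k, qpoch_inf (b * v) q * Csum (F k) = sterm q A a d b u v T k) as E1.
  { intro k.
    transitivity (qpoch_inf (b * v) q *
      Csum (fun i => qpoch A q k * (om k * (b * u) ^ k)
                     * (qpoch (A * q ^ k) q i / qpoch q q i * (b * v) ^ i))).
    - f_equal; apply Csum_ext; intro i; unfold F; rewrite qpoch_add.
      field; apply qpoch_neq0; assumption.
    - rewrite Csum_scal.
      + rewrite q_binomial by assumption. unfold sterm; fold (om k).
        replace (A * q ^ k * (b * v)) with (A * (b * v) * q ^ k) by ring.
        unfold om. field; repeat split; try assumption; apply qpoch_neq0; assumption.
      + destruct (qpoch_bounded q q_gt0 q_lt1 (Cnorm A) (Cnorm_ge0 _)) as [M5 [P5 H5]].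
        apply dominated_geom with (M5 * M3)%R (b * v); [assumption|]. intro i.
        unfold Cdiv; rewrite (Cnorm_mul (_ * Cinv _)), Cnorm_pow, Cnorm_mul.
        apply Rmult_le_compat_r; [apply pow_le, Cnorm_ge0|].
        apply Rmult_le_compat; try apply Cnorm_ge0.
        * apply H5, mul_qpow_norm_le; assumption.
        * apply H3; lra. }
  assert (Csum (fun k => Csum (F k))
    = Csum (fun n => qpoch A q n / qpoch q q n * b ^ n * conv q a d u v T n)) as E2.
  { rewrite (Csum_diagonal F (fun k => M1 * M * Cnorm (b * u) ^ k)%R
      (fun i => M3 * Cnorm (b * v) ^ i)%R).
    - apply Csum_ext; intro n. unfold conv; rewrite <- Cpartial_scal.
      apply Cpartial_ext; intros k Hk. unfold F, om, wcoef.
      pose proof (gauss_closed q v k (n - k)) as G.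
      replace (k + (n - k))%nat with n in * by lia.
      assert (gauss q v n k = qpoch q q n * v ^ (n - k) / (qpoch q q k * qpoch q q (n - k))) as ->
        by (rewrite <- G; field; split; apply qpoch_neq0; assumption).
      replace (b ^ n) with (b ^ k * b ^ (n - k)) by (rewrite <- Cpow_add; f_equal; lia).
      rewrite !Cpow_mul_base.
      field; repeat split; apply qpoch_neq0; assumption.
    - apply summable_scal; [nra|]. apply summable_geom; split; [apply Cnorm_ge0|assumption].
    - apply summable_scal; [lra|]. apply summable_geom; split; [apply Cnorm_ge0|assumption].
    - intros k i; unfold F, Cdiv at 1.
      replace (qpoch A q (k + i) * (om k * (b * u) ^ k) * ((b * v) ^ i * Cinv (qpoch q q i)))
        with ((qpoch A q (k + i) * om k * (b * u) ^ k) * (Cinv (qpoch q q i) * (b * v) ^ i)) by ring.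
      rewrite (Cnorm_mul (_ * _ * _)), (Cnorm_mul (Cinv _)), (Cnorm_mul (_ * om k)),
        (Cnorm_mul _ (om k)), !Cnorm_pow.
      specialize (HM k); fold (om k) in HM.
      repeat (apply Rmult_le_compat; repeat apply Rmult_le_pos; try apply Cnorm_ge0;
        try (apply pow_le, Cnorm_ge0); try assumption; try apply Rle_refl).
      + apply H1; lra.
      + apply H3; lra. }
  rewrite <- E2, <- Csum_scal.
  - apply Csum_ext; intro k; symmetry; apply E1.
  - apply dominated_ext with (fun k => Cinv (qpoch_inf (b * v) q) * sterm q A a d b u v T k).
    + intro k; rewrite <- E1; field; exact NZ.
    + apply dominated_scal, sterm_dominated.
Qed.

End ConvSeries.

Lemma Csum_sterm_sym q A a d b u v T T' : (0 < Cnorm q)%R -> (Cnorm q < 1)%R ->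
  (Cnorm (a * d * u * v) < 1)%R -> (Cnorm (b * u) < 1)%R -> (Cnorm (b * v) < 1)%R ->
  (exists M, forall k, (Cnorm (T k) <= M)%R) -> (exists M, forall k, (Cnorm (T' k) <= M)%R) ->
  (forall n, conv q a d u v T n = conv q a d v u T' n) ->
  qpoch_inf (b * u) q * Csum (sterm q A a d b u v T)
  = qpoch_inf (b * v) q * Csum (sterm q A a d b v u T').
Proof.
  intros q0 q1 H Hu Hv HT HT' E.
  rewrite !Csum_sterm; try assumption; [|apply advu_lt1, H].
  rewrite (Csum_ext _ (fun n => qpoch A q n / qpoch q q n * b ^ n * conv q a d v u T' n))
    by (intro n; rewrite E; reflexivity).
  ring.
Qed.

Lemma one_bounded : exists M, forall k : nat, (Cnorm ((fun _ => C1) k) <= M)%R.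
Proof. exists 1%R; intros; rewrite Cnorm_C1; apply Rle_refl. Qed.

(* The 3phi2 transformation (III.9) of Gasper and Rahman, freed of denominators that
   involve A. *)
Lemma sears_transformation q A B C y w : (0 < Cnorm q)%R -> (Cnorm q < 1)%R ->
  (Cnorm (B * C * y) < 1)%R -> (Cnorm w < 1)%R -> (Cnorm (w * y) < 1)%R ->
  qpoch_inf (w * y) q * Csum (fun k => qpoch A q k * qpoch_inf (A * w * q ^ k) q
    * (qpoch B q k * qpoch C q k / (qpoch q q k * qpoch (B * C * y) q k)) * (w * y) ^ k)
  = qpoch_inf w q * Csum (fun k => qpoch A q k * qpoch_inf (A * (w * y) * q ^ k) q
    * (qpoch (B * y) q k * qpoch (C * y) q k / (qpoch q q k * qpoch (B * C * y) q k)) * w ^ k).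
Proof.
  intros q0 q1 H Hw Hwy.
  assert (forall x, x * C1 = x) as R1 by (intro; ring).
  (* Specialized to u = y and v = 1: exchanging them turns B, C with argument wy into By, Cy with
     argument w. *)
  pose proof (Csum_sterm_sym q A B C w y C1 (fun _ => C1) (fun _ => C1) q0 q1) as S.
  rewrite !R1 in S. specialize (S H Hwy Hw one_bounded one_bounded).
  assert (forall n, conv q B C y C1 (fun _ => C1) n = conv q B C C1 y (fun _ => C1) n) as E.
  { intro n; apply conv1_sym; try assumption. rewrite R1; exact H. }
  specialize (S E).
  unfold sterm in S. rewrite !R1 in S. replace (B * C * C1 * y) with (B * C * y) in S by ring.
  transitivity (qpoch_inf (w * y) q * Csum (fun k => qpoch A q k * qpoch_inf (A * w * q ^ k) q
    * (qpoch B q k * qpoch C q k / (qpoch q q k * qpoch (B * C * y) q k)) * (w * y) ^ k * C1)).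
  { f_equal; apply Csum_ext; intro; ring. }
  rewrite S. f_equal; apply Csum_ext; intro; ring.
Qed.

(** * The reciprocity theorem for b = 0 *)

(* The case b = 0 of the theorem with c and d exchanged. *)
Definition recip (q a c d u v : CC) : CC :=
  v * Csum (rterm q a c d u v) - u * Csum (rterm q a c d v u).

Section Reciprocity.

Variable q : CC.
Hypothesis q_gt0 : (0 < Cnorm q)%R.
Hypothesis q_lt1 : (Cnorm q < 1)%R.

(** Each factor divided by z has modulus at most 1 + K |q|^k. The bound is uniform in [c], as needed
    when c q^j tends to 0. *)
Lemma hpoch_bounded u v z : z <> C0 -> exists M, (0 < M)%R /\
  forall c n, (Cnorm (c * v) <= Cnorm z)%R -> (Cnorm (hpoch q c u v n) <= M * Cnorm z ^ n)%R.
Proof.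
  intros Hz. pose proof (Cnorm_gt0 z Hz).
  set (K := Cnorm (q * (v / u) / z)).
  exists (exp (K / (1 - Cnorm q))); split; [apply exp_pos|]. intros c n Hc.
  assert (forall f, Cprod f n = Cprod (fun j => f j / z) n * z ^ n) as E.
  { intro f; clear Hc. induction n as [|n IH]; simpl; [ring|]. rewrite IH; field; exact Hz. }
  unfold hpoch; rewrite E.
  rewrite Cnorm_mul, Cnorm_pow.
  apply Rmult_le_compat_r; [apply pow_le, Cnorm_ge0|].
  apply Cprod_norm_le; try assumption; [apply Cnorm_ge0|]. intro k.
  replace ((c * v - q ^ S k * v / u) / z) with (c * v * Cinv z - q * (v / u) / z * q ^ k)
    by (unfold Cdiv; simpl; ring).
  eapply Rle_trans; [apply Cnorm_sub|].
  apply Rplus_le_compat.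
  - rewrite Cnorm_mul, Cnorm_inv by exact Hz.
    apply Rmult_le_reg_r with (Cnorm z); [assumption|].
    rewrite Rmult_assoc, Rinv_l by lra. lra.
  - rewrite Cnorm_mul, Cnorm_pow; apply Rle_refl.
Qed.

(** A nonzero ratio is required because factors are divided by it; for x = 0 the number q serves. *)
Lemma small_majorant x : (Cnorm x < 1)%R ->
  exists z, z <> C0 /\ (Cnorm z < 1)%R /\ (Cnorm x <= Cnorm z)%R.
Proof.
  intros Hx; destruct (classic (x = C0)) as [->|N].
  - exists q; rewrite Cnorm_C0; repeat split; [apply q_neq0| |]; lra.
  - exists x; repeat split; [exact N|exact Hx|apply Rle_refl].
Qed.

Lemma rterm_bounded a d u v z : z <> C0 ->
  (Cnorm (a * v) < 1)%R -> (Cnorm (d * v) < 1)%R ->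
  exists M, (0 < M)%R /\ forall a' c n, (Cnorm a' <= Cnorm a)%R -> (Cnorm (c * v) <= Cnorm z)%R ->
    (Cnorm (rterm q a' c d u v n) <= M * Cnorm z ^ n)%R.
Proof.
  intros Hz Ha Hd.
  destruct (hpoch_bounded u v z Hz) as [M1 [P1 H1]].
  destruct (qpoch_bounded q q_gt0 q_lt1 (Cnorm (a * (d * u * v))) (Cnorm_ge0 _)) as [M2 [P2 H2]].
  destruct (qpoch_inv_bounded q q_gt0 q_lt1 (Cnorm (a * v))) as [M3 [P3 H3]];
    [split; [apply Cnorm_ge0|assumption]|].
  destruct (qpoch_inv_bounded q q_gt0 q_lt1 (Cnorm (d * v))) as [M4 [P4 H4]];
    [split; [apply Cnorm_ge0|assumption]|].
  exists (M1 * (M2 * (M3 * M4)))%R; split; [repeat apply Rmult_lt_0_compat; assumption|].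
  intros a' c n Ha' Hc.
  assert (Cnorm (a' * v) <= Cnorm (a * v))%R as Hav.
  { rewrite !Cnorm_mul; apply Rmult_le_compat_r; [apply Cnorm_ge0|exact Ha']. }
  assert (rterm q a' c d u v n = hpoch q c u v n * (qpoch (a' * (d * u * v)) q n
    * (Cinv (qpoch (a' * v) q (S n)) * Cinv (qpoch (d * v) q (S n))))) as ->.
  { unfold rterm. replace (a' * d * u * v) with (a' * (d * u * v)) by ring.
    field; split; apply qpoch_neq0; try assumption. lra. }
  rewrite !Cnorm_mul.
  replace (M1 * (M2 * (M3 * M4)) * Cnorm z ^ n)%R
    with ((M1 * Cnorm z ^ n) * (M2 * (M3 * M4)))%R by ring.
  specialize (H1 c n Hc). specialize (H3 _ (S n) Hav). specialize (H4 _ (S n) (Rle_refl _)).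
  repeat (apply Rmult_le_compat; repeat apply Rmult_le_pos; try apply Cnorm_ge0; try assumption).
  apply H2. rewrite !(Cnorm_mul _ (d * u * v)).
  apply Rmult_le_compat_r; [apply Cnorm_ge0|exact Ha'].
Qed.

Lemma rterm_dominated a c d u v : (Cnorm (a * v) < 1)%R -> (Cnorm (c * v) < 1)%R ->
  (Cnorm (d * v) < 1)%R -> dominated (rterm q a c d u v).
Proof.
  intros Ha Hc Hd.
  destruct (small_majorant _ Hc) as [z [Z0 [Z1 Hz]]].
  destruct (rterm_bounded a d u v z Z0 Ha Hd) as [M [M0 HM]].
  apply dominated_geom with M z; [exact Z1|].
  intro n; apply HM; [apply Rle_refl|exact Hz].
Qed.

Lemma rterm_swap a c d u v n : rterm q a c d u v n = rterm q d c a u v n.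
Proof.
  unfold rterm. replace (d * a * u * v) with (a * d * u * v) by ring.
  f_equal; ring.
Qed.

Lemma recip_swap a c d u v : recip q a c d u v = recip q d c a u v.
Proof.
  unfold recip. rewrite (Csum_ext _ _ (rterm_swap a c d u v)), (Csum_ext _ _ (rterm_swap a c d v u)).
  reflexivity.
Qed.

(** Creative telescoping for the shift from a to aq; the inhomogeneity is the value of the
    certificate at n = 0. *)
Lemma rsum_shift a c d u v : u <> C0 -> (Cnorm (a * d * u * v) < 1)%R ->
  (Cnorm (a * v) < 1)%R -> (Cnorm (c * v) < 1)%R -> (Cnorm (d * v) < 1)%R ->
  (C1 - a * u) * (C1 - a * v) * Csum (rterm q a c d u v)
  + Copp ((C1 - a * d * u * v) * (C1 - a * c * u * v)) * Csum (rterm q (a * q) c d u v)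
  = C0 - a * u.
Proof.
  intros Hu Had Ha Hc Hd.
  assert (Cnorm (a * q * v) < 1)%R as Haq.
  { replace (a * q * v) with (a * v * q ^ 1) by (simpl; ring). apply mul_qpow_norm_lt1; assumption. }
  (* This is a u (1 - a v)(1 - d v q^n) times the n-th term of the unshifted series, after
     cancellation; hence it starts at a u and tends to 0 with the terms. *)
  set (g := fun n => a * u * hpoch q c u v n * qpoch (a * d * u * v) q n
                     / (qpoch (a * q * v) q n * qpoch (d * v) q n)).
  replace (C0 - a * u) with (C0 - g O) by (unfold g, hpoch, qpoch; simpl; field; intro H; injection H; lra).
  apply Csum_telescope2.
  - apply rterm_dominated; assumption.
  - apply rterm_dominated; assumption.
  - intro n; unfold rterm, g.
    pose proof (qpoch_recl (a * v) q n) as E1.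
    replace (a * v * q) with (a * q * v) in E1 by ring.
    pose proof (qpoch_recl (a * d * u * v) q n) as E2. rewrite qpoch_S in E2.
    replace (a * d * u * v * q) with (a * q * d * u * v) in E2 by ring.
    assert (C1 - a * d * u * v <> C0) as N1 by (apply one_sub_neq0; assumption).
    assert (C1 - a * v <> C0) as N2 by (apply one_sub_neq0; assumption).
    assert (qpoch (a * q * d * u * v) q n = qpoch (a * d * u * v) q n
      * (C1 - a * d * u * v * q ^ n) / (C1 - a * d * u * v)) as E3
      by (rewrite E2; field; exact N1).
    rewrite E1, E3, !qpoch_S.
    change (hpoch q c u v (S n)) with (hpoch q c u v n * (c * v - q ^ S n * v / u)).
    simpl Cpow. field.
    repeat split; try assumption; try (apply qpoch_neq0; assumption);
      apply (one_sub_neq0 (_ * q ^ n)), mul_qpow_norm_lt1; assumption.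
  - destruct (small_majorant _ Hc) as [z [Z0 [Z1 Hz]]].
    destruct (rterm_bounded a d u v z Z0 Ha Hd) as [M [M0 HM]].
    apply Ccv_geom with (Cnorm (a * u) * (4 * M))%R z; [exact Z1|]. intro n.
    specialize (HM a c n (Rle_refl _) Hz).
    assert (g n = a * u * ((C1 - a * v) * (C1 - d * v * q ^ n) * rterm q a c d u v n)) as ->.
    { unfold g, rterm. rewrite qpoch_recl, (qpoch_S (d * v)).
      replace (a * v * q) with (a * q * v) by ring. field.
      repeat split; try (apply qpoch_neq0; assumption).
      - apply (one_sub_neq0 (_ * q ^ n)), mul_qpow_norm_lt1; assumption.
      - apply one_sub_neq0; assumption. }
    rewrite (Cnorm_mul (a * u)), Rmult_assoc.
    apply Rmult_le_compat_l; [apply Cnorm_ge0|].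
    rewrite (Cnorm_mul (_ * _)), (Cnorm_mul (C1 - a * v)).
    replace (4 * M * Cnorm z ^ n)%R with (2 * 2 * (M * Cnorm z ^ n))%R by ring.
    assert (forall x, (Cnorm x < 1)%R -> (Cnorm (C1 - x) <= 2)%R) as B.
    { intros x Hx; pose proof (Cnorm_sub C1 x) as T; rewrite Cnorm_C1 in T; lra. }
    apply Rmult_le_compat; [apply Rmult_le_pos; apply Cnorm_ge0|apply Cnorm_ge0| |exact HM].
    apply Rmult_le_compat; try apply Cnorm_ge0; apply B; [assumption|].
    apply mul_qpow_norm_lt1; assumption.
Qed.

Lemma aduv_norm_lt1 a d u v : (Cnorm (a * u) < 1)%R -> (Cnorm (d * v) < 1)%R ->
  (Cnorm (a * d * u * v) < 1)%R.
Proof.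
  intros H H'. replace (a * d * u * v) with ((a * u) * (d * v)) by ring.
  rewrite Cnorm_mul. pose proof (Cnorm_ge0 (a * u)). pose proof (Cnorm_ge0 (d * v)). nra.
Qed.

(** Multiplied by v and by u respectively, the inhomogeneities -au and -av both become -auv and
    cancel in the difference. *)
Lemma recip_shift a c d u v : u <> C0 -> v <> C0 ->
  (Cnorm (a * u) < 1)%R -> (Cnorm (a * v) < 1)%R -> (Cnorm (c * u) < 1)%R ->
  (Cnorm (c * v) < 1)%R -> (Cnorm (d * u) < 1)%R -> (Cnorm (d * v) < 1)%R ->
  (C1 - a * u) * (C1 - a * v) * recip q a c d u v
  = (C1 - a * d * u * v) * (C1 - a * c * u * v) * recip q (a * q) c d u v.
Proof.
  intros Hu Hv Hau Hav Hcu Hcv Hdu Hdv.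
  pose proof (rsum_shift a c d u v Hu (aduv_norm_lt1 _ _ _ _ Hau Hdv) Hav Hcv Hdv) as E.
  pose proof (rsum_shift a c d v u Hv (aduv_norm_lt1 _ _ _ _ Hav Hdu) Hau Hcu Hdu) as E'.
  unfold recip.
  set (X := Csum (rterm q a c d u v)) in *. set (Y := Csum (rterm q a c d v u)) in *.
  set (X' := Csum (rterm q (a * q) c d u v)) in *. set (Y' := Csum (rterm q (a * q) c d v u)) in *.
  transitivity (v * ((C1 - a * u) * (C1 - a * v) * X
    + Copp ((C1 - a * d * u * v) * (C1 - a * c * u * v)) * X')
    - u * ((C1 - a * v) * (C1 - a * u) * Y
    + Copp ((C1 - a * d * v * u) * (C1 - a * c * v * u)) * Y')
    + (C1 - a * d * u * v) * (C1 - a * c * u * v) * (v * X' - u * Y')); [ring|].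
  rewrite E, E'; ring.
Qed.

Lemma mul_swap_norm_lt1 x y k : (Cnorm (x * y) < 1)%R -> (Cnorm (x * q ^ k * y) < 1)%R.
Proof.
  intro H; replace (x * q ^ k * y) with (x * y * q ^ k) by ring. apply mul_qpow_norm_lt1; assumption.
Qed.

Lemma rsum_cv0 a c d u v : (Cnorm (a * v) < 1)%R -> (Cnorm (c * v) < 1)%R ->
  (Cnorm (d * v) < 1)%R ->
  Ccv (fun j => Csum (rterm q (a * q ^ j) c d u v)) (Csum (rterm q C0 c d u v)).
Proof.
  intros Ha Hc Hd.
  destruct (small_majorant _ Hc) as [z [Z0 [Z1 Hz]]].
  destruct (rterm_bounded a d u v z Z0 Ha Hd) as [M [M0 HM]].
  apply Csum_Tannery with (fun n => M * Cnorm z ^ n)%R.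
  - apply summable_scal; [lra|]. apply summable_geom; split; [apply Cnorm_ge0|exact Z1].
  - intros j n; apply HM; [apply mul_qpow_norm_le; assumption|exact Hz].
  - intro n.
    assert (forall e, rterm q C0 c e u v n = hpoch q c u v n
       * C1 * (C1 * Cinv (qpoch (e * v) q (S n)))) as E0.
    { intro e; unfold rterm, Cdiv.
      replace (C0 * e * u * v) with C0 by ring. replace (C0 * v) with C0 by ring.
      rewrite !qpoch_0l. replace (C1 * qpoch (e * v) q (S n)) with (qpoch (e * v) q (S n)) by ring.
      ring. }
    rewrite E0.
    apply Ccv_ext with (fun j => hpoch q c u v n * qpoch (a * d * u * v * q ^ j) q n
      * (Cinv (qpoch (a * v * q ^ j) q (S n)) * Cinv (qpoch (d * v) q (S n)))).
    + intro j; unfold rterm.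
      replace (a * q ^ j * d * u * v) with (a * d * u * v * q ^ j) by ring.
      replace (a * q ^ j * v) with (a * v * q ^ j) by ring.
      field; split; apply qpoch_neq0; try assumption. apply mul_qpow_norm_lt1; assumption.
    + apply Ccv_mul; [apply Ccv_scal, qpoch_cv0; assumption|].
      apply Ccv_mul; [|apply Ccv_const].
      replace C1 with (Cinv C1) by (field; intro H; injection H; lra).
      apply Ccv_inv.
      * apply qpoch_cv0; assumption.
      * intro H; injection H; lra.
      * intro j; apply qpoch_neq0; try assumption. apply mul_qpow_norm_lt1; assumption.
Qed.

Lemma recip_reduce a c d u v : u <> C0 -> v <> C0 ->
  (Cnorm (a * u) < 1)%R -> (Cnorm (a * v) < 1)%R -> (Cnorm (c * u) < 1)%R ->
  (Cnorm (c * v) < 1)%R -> (Cnorm (d * u) < 1)%R -> (Cnorm (d * v) < 1)%R ->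
  qpoch_inf (a * u) q * qpoch_inf (a * v) q * recip q a c d u v
  = qpoch_inf (a * d * u * v) q * qpoch_inf (a * c * u * v) q * recip q C0 c d u v.
Proof.
  intros Hu Hv Hau Hav Hcu Hcv Hdu Hdv.
  apply Ccv_unique with
    (fun j => qpoch (a * u) q j * qpoch (a * v) q j * recip q a c d u v).
  - repeat apply Ccv_mul; try (apply qpoch_inf_cv; assumption). apply Ccv_const.
  - apply Ccv_ext with (fun j => qpoch (a * d * u * v) q j * qpoch (a * c * u * v) q j
      * recip q (a * q ^ j) c d u v).
    + induction n as [|j IH].
      * unfold qpoch; simpl. replace (a * C1) with a by ring. reflexivity.
      * pose proof (recip_shift (a * q ^ j) c d u v Hu Hv (mul_swap_norm_lt1 _ _ j Hau)
          (mul_swap_norm_lt1 _ _ j Hav) Hcu Hcv Hdu Hdv) as E.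
        rewrite !qpoch_S. replace (a * q ^ S j) with (a * q ^ j * q) by (simpl; ring).
        transitivity (qpoch (a * d * u * v) q j * qpoch (a * c * u * v) q j *
          ((C1 - a * q ^ j * d * u * v) * (C1 - a * q ^ j * c * u * v)
            * recip q (a * q ^ j * q) c d u v)); [ring|].
        rewrite <- E.
        transitivity ((C1 - a * q ^ j * u) * (C1 - a * q ^ j * v) *
          (qpoch (a * d * u * v) q j * qpoch (a * c * u * v) q j * recip q (a * q ^ j) c d u v));
          [ring|].
        rewrite IH; ring.
    + repeat apply Ccv_mul; try (apply qpoch_inf_cv; assumption).
      unfold recip.
      apply Ccv_ext with (fun j => v * Csum (rterm q (a * q ^ j) c d u v)
        + Copp u * Csum (rterm q (a * q ^ j) c d v u)); [intro; ring|].
      replace (v * Csum (rterm q C0 c d u v) - u * Csum (rterm q C0 c d v u))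
        with (v * Csum (rterm q C0 c d u v) + Copp u * Csum (rterm q C0 c d v u)) by ring.
      apply Ccv_add; apply Ccv_scal; apply rsum_cv0; assumption.
Qed.

(** * Reciprocity with a = d = 0: the parameter c alone *)

Lemma rterm_00 c u v n : rterm q C0 c C0 u v n = hpoch q c u v n.
Proof.
  unfold rterm. replace (C0 * C0 * u * v) with C0 by ring. replace (C0 * v) with C0 by ring.
  rewrite !qpoch_0l. field; intro H; injection H; lra.
Qed.

(** The factor j of the product at cq is q times the factor j - 1 at c. Hence both sides equal
    q^(n+1) (v/u)(cu - 1) times [hpoch q c u v n]. *)
Lemma hpoch_shift c u v n : u <> C0 ->
  hpoch q (c * q) u v (S n) = (c * u - C1) * (c * v * hpoch q c u v n - hpoch q c u v (S n)).
Proof.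
  intros Hu. change (hpoch q c u v (S n)) with (hpoch q c u v n * (c * v - q ^ S n * v / u)).
  induction n as [|n IH]; [unfold hpoch; simpl; field; exact Hu|].
  change (hpoch q (c * q) u v (S (S n)))
    with (hpoch q (c * q) u v (S n) * (c * q * v - q ^ S (S n) * v / u)).
  rewrite IH. change (hpoch q c u v (S n)) with (hpoch q c u v n * (c * v - q ^ S n * v / u)).
  simpl Cpow. field; exact Hu.
Qed.

Lemma hpoch_dominated c u v : (Cnorm (c * v) < 1)%R -> dominated (hpoch q c u v).
Proof.
  intros Hc. destruct (small_majorant _ Hc) as [z [Z0 [Z1 Hz]]].
  destruct (hpoch_bounded u v z Z0) as [M [M0 HM]].
  apply dominated_geom with M z; auto.
Qed.

Lemma hsum_shift c u v : u <> C0 -> (Cnorm (c * v) < 1)%R ->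
  (C1 - c * u) * (C1 - c * v) * Csum (hpoch q c u v) + Copp C1 * Csum (hpoch q (c * q) u v)
  = C0 - c * u.
Proof.
  intros Hu Hc.
  (* The certificate at n + 1 uses the product of index n, because [hpoch_shift] links the indices n
     and n + 1; the value at 0 is what the first term requires. *)
  set (g := fun n => match n with O => c * u
             | S m => Copp ((C1 - c * u) * (c * v)) * hpoch q c u v m end).
  change (c * u) with (g O) at 2.
  apply Csum_telescope2.
  - apply hpoch_dominated, Hc.
  - apply hpoch_dominated. replace (c * q * v) with (c * v * q ^ 1) by (simpl; ring).
    apply mul_qpow_norm_lt1; assumption.
  - intros [|n]; [unfold g, hpoch; simpl; ring|].
    rewrite hpoch_shift by exact Hu. unfold g; ring.
  - destruct (small_majorant _ Hc) as [z [Z0 [Z1 Hz]]].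
    destruct (hpoch_bounded u v z Z0) as [M [M0 HM]].
    apply (Ccv_unshift 1).
    apply Ccv_ext with (fun n => Copp ((C1 - c * u) * (c * v)) * hpoch q c u v n).
    + intro n; rewrite Nat.add_1_r; reflexivity.
    + replace C0 with (Copp ((C1 - c * u) * (c * v)) * C0) by ring.
      apply Ccv_scal, Ccv_geom with M z; auto.
Qed.

Definition hrecip c u v := v * Csum (hpoch q c u v) - u * Csum (hpoch q c v u).

Lemma hsum_cv0 c u v : (Cnorm (c * v) < 1)%R ->
  Ccv (fun j => Csum (hpoch q (c * q ^ j) u v)) (Csum (hpoch q C0 u v)).
Proof.
  intros Hc. destruct (small_majorant _ Hc) as [z [Z0 [Z1 Hz]]].
  destruct (hpoch_bounded u v z Z0) as [M [M0 HM]].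
  apply Csum_Tannery with (fun n => M * Cnorm z ^ n)%R.
  - apply summable_scal; [lra|]. apply summable_geom; split; [apply Cnorm_ge0|exact Z1].
  - intros j n; apply HM. replace (c * q ^ j * v) with (c * v * q ^ j) by ring.
    eapply Rle_trans; [apply mul_qpow_norm_le; assumption|exact Hz].
  - induction n as [|n IH]; [apply (Ccv_const C1)|].
    change (hpoch q C0 u v (S n)) with (hpoch q C0 u v n * (C0 * v - q ^ S n * v / u)).
    apply Ccv_mul; [exact IH|].
    apply Ccv_ext with (fun j => v * (c * q ^ j) + Copp (q ^ S n * v / u)); [intro; ring|].
    replace (C0 * v - q ^ S n * v / u) with (v * C0 + Copp (q ^ S n * v / u)) by ring.
    apply Ccv_add; [apply Ccv_scal, Ccv_mul_qpow0; assumption|apply Ccv_const].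
Qed.

Lemma hrecip_reduce c u v : u <> C0 -> v <> C0 ->
  (Cnorm (c * u) < 1)%R -> (Cnorm (c * v) < 1)%R ->
  qpoch_inf (c * u) q * qpoch_inf (c * v) q * hrecip c u v = hrecip C0 u v.
Proof.
  intros Hu Hv Hcu Hcv.
  apply Ccv_unique with (fun j => qpoch (c * u) q j * qpoch (c * v) q j * hrecip c u v).
  - repeat apply Ccv_mul; try (apply qpoch_inf_cv; assumption). apply Ccv_const.
  - apply Ccv_ext with (fun j => hrecip (c * q ^ j) u v).
    + induction n as [|j IH].
      * unfold qpoch; simpl. replace (c * C1) with c by ring. ring.
      * pose proof (hsum_shift (c * q ^ j) u v Hu (mul_swap_norm_lt1 _ _ j Hcv)) as E.
        pose proof (hsum_shift (c * q ^ j) v u Hv (mul_swap_norm_lt1 _ _ j Hcu)) as E'.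
        rewrite !qpoch_S.
        transitivity ((C1 - c * q ^ j * u) * (C1 - c * q ^ j * v) *
          (qpoch (c * u) q j * qpoch (c * v) q j * hrecip c u v)); [|ring].
        rewrite <- IH. unfold hrecip.
        replace (c * q ^ S j) with (c * q ^ j * q) by (simpl; ring).
        set (e := c * q ^ j) in *.
        set (X := Csum (hpoch q e u v)) in *. set (Y := Csum (hpoch q e v u)) in *.
        set (X' := Csum (hpoch q (e * q) u v)) in *. set (Y' := Csum (hpoch q (e * q) v u)) in *.
        transitivity ((C1 - e * u) * (C1 - e * v) * (v * X - u * Y)
          - v * ((C1 - e * u) * (C1 - e * v) * X + Copp C1 * X')
          + u * ((C1 - e * v) * (C1 - e * u) * Y + Copp C1 * Y')); [ring|].
        rewrite E, E'; ring.
    + unfold hrecip.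
      apply Ccv_ext with (fun j => v * Csum (hpoch q (c * q ^ j) u v)
        + Copp u * Csum (hpoch q (c * q ^ j) v u)); [intro; ring|].
      replace (v * Csum (hpoch q C0 u v) - u * Csum (hpoch q C0 v u))
        with (v * Csum (hpoch q C0 u v) + Copp u * Csum (hpoch q C0 v u)) by ring.
      apply Ccv_add; apply Ccv_scal, hsum_cv0; assumption.
Qed.

(* At c = q/u the first series reduces to its first term and the second one telescopes. *)
Lemma hrecip_0_aux u v : u <> C0 -> v <> C0 -> (Cnorm v <= Cnorm u)%R ->
  hrecip C0 u v = qDelta q u v.
Proof.
  intros Hu Hv L.
  assert (q / u * u = q) as E1 by (field; exact Hu).
  assert (q / u * v = q * v / u) as E2 by (field; exact Hu).
  assert (Cnorm (q * v / u) < 1)%R as H2.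
  { unfold Cdiv; rewrite !Cnorm_mul, Cnorm_inv by exact Hu.
    pose proof (Cnorm_gt0 u Hu).
    apply Rmult_lt_reg_r with (Cnorm u); [assumption|].
    rewrite Rmult_assoc, Rinv_l by lra. pose proof (Cnorm_gt0 v Hv). nra. }
  assert (Cnorm (q / u * u) < 1)%R as H1' by (rewrite E1; assumption).
  assert (Cnorm (q / u * v) < 1)%R as H2' by (rewrite E2; assumption).
  rewrite <- (hrecip_reduce (q / u) u v Hu Hv H1' H2').
  rewrite E1, E2. unfold qDelta.
  assert (hrecip (q / u) u v = v * qpoch_inf (u / v) q) as ->; [|ring].
  unfold hrecip.
  rewrite (Csum_single (hpoch q (q / u) u v)).
  (* The factor of index 0 is (q/u) v - q v/u = 0. *)
  2:{ intro n; induction n as [|n IH]; [unfold hpoch; simpl; field; exact Hu|].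
      change (hpoch q (q / u) u v (S (S n)))
        with (hpoch q (q / u) u v (S n) * (q / u * v - q ^ S (S n) * v / u)).
      rewrite IH; ring. }
  assert (forall n, hpoch q (q / u) v u n = q ^ n * qpoch (u / v) q n) as E3.
  { induction n as [|n IH]; [unfold hpoch, qpoch; simpl; ring|].
    change (hpoch q (q / u) v u (S n))
      with (hpoch q (q / u) v u n * (q / u * u - q ^ S n * u / v)).
    rewrite IH, qpoch_S; simpl Cpow; field; split; assumption. }
  (* The term u q^n (u/v)_n equals -v times the difference (u/v)_(n+1) - (u/v)_n. *)
  assert (u * Csum (hpoch q (q / u) v u) = Copp v * (qpoch_inf (u / v) q - C1)) as ->.
  { change C1 with (qpoch (u / v) q 0) at 1.
    rewrite <- (Csum_telescope (qpoch (u / v) q)) by (apply qpoch_inf_cv; assumption).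
    rewrite <- !Csum_scal.
    - apply Csum_ext; intro n; rewrite E3, qpoch_S; field; exact Hv.
    - apply dominated_ext with (fun n => Copp (u / v) * hpoch q (q / u) v u n).
      + intro n; rewrite E3, qpoch_S; ring.
      + apply dominated_scal, hpoch_dominated; assumption.
    - apply hpoch_dominated; assumption. }
  unfold hpoch; simpl; ring.
Qed.

(** The value c = q/u is admissible only when |qv/u| < 1, which |v| <= |u| guarantees. Otherwise u
    and v are exchanged: both sides change sign, for [qDelta] because -u (1 - v/u) = v (1 - u/v). *)
Lemma hrecip_0 u v : u <> C0 -> v <> C0 -> hrecip C0 u v = qDelta q u v.
Proof.
  intros Hu Hv. destruct (Rle_lt_dec (Cnorm v) (Cnorm u)) as [L|L];
    [apply hrecip_0_aux; assumption|].
  transitivity (Copp (hrecip C0 v u)); [unfold hrecip; ring|].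
  rewrite hrecip_0_aux by (assumption || lra). unfold qDelta.
  rewrite (qpoch_inf_recl q q_gt0 q_lt1 (v / u)), (qpoch_inf_recl q q_gt0 q_lt1 (u / v)).
  replace (v / u * q) with (q * v / u) by (field; exact Hu).
  replace (u / v * q) with (q * u / v) by (field; exact Hv).
  field; split; assumption.
Qed.

(** First a is sent to 0, then d, which the symmetry of [rterm] in a and d allows by the same lemma.
    The rest depends on c only and is [hrecip]. *)
Lemma recip_product a c d u v : u <> C0 -> v <> C0 ->
  (Cnorm (a * u) < 1)%R -> (Cnorm (a * v) < 1)%R -> (Cnorm (c * u) < 1)%R ->
  (Cnorm (c * v) < 1)%R -> (Cnorm (d * u) < 1)%R -> (Cnorm (d * v) < 1)%R ->
  recip q a c d u v = qDelta q u v * qpoch_inf (a * c * u * v) q * qpoch_inf (a * d * u * v) q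
    * qpoch_inf (c * d * u * v) q
  / (qpoch_inf (a * u) q * qpoch_inf (a * v) q * qpoch_inf (c * u) q * qpoch_inf (c * v) q
     * qpoch_inf (d * u) q * qpoch_inf (d * v) q).
Proof.
  intros Hu Hv Hau Hav Hcu Hcv Hdu Hdv.
  assert (forall x, (Cnorm (C0 * x) < 1)%R) as Z.
  { intro x; replace (C0 * x) with C0 by ring. rewrite Cnorm_C0; lra. }
  pose proof (recip_reduce a c d u v Hu Hv Hau Hav Hcu Hcv Hdu Hdv) as E1.
  rewrite (recip_swap C0 c d u v) in E1.
  pose proof (recip_reduce d c C0 u v Hu Hv Hdu Hdv Hcu Hcv (Z u) (Z v)) as E2.
  replace (d * C0 * u * v) with C0 in E2 by ring.
  rewrite qpoch_inf_0 in E2.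
  assert (recip q C0 c C0 u v = hrecip c u v) as E3.
  { unfold recip, hrecip.
    rewrite (Csum_ext _ _ (rterm_00 c u v)), (Csum_ext _ _ (rterm_00 c v u)). reflexivity. }
  pose proof (hrecip_reduce c u v Hu Hv Hcu Hcv) as E4.
  rewrite hrecip_0 in E4 by assumption.
  rewrite <- E4, <- E3.
  replace (c * d * u * v) with (d * c * u * v) by ring.
  assert (forall x, (Cnorm x < 1)%R -> qpoch_inf x q <> C0) as NZ
    by (intros; apply qpoch_inf_neq0; assumption).
  assert (recip q a c d u v = (qpoch_inf (a * u) q * qpoch_inf (a * v) q * recip q a c d u v)
     / (qpoch_inf (a * u) q * qpoch_inf (a * v) q)) as -> by (field; auto).
  rewrite E1.
  assert (recip q d c C0 u v = (qpoch_inf (d * u) q * qpoch_inf (d * v) q * recip q d c C0 u v)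
     / (qpoch_inf (d * u) q * qpoch_inf (d * v) q)) as -> by (field; auto).
  rewrite E2. field. repeat split; auto.
Qed.

End Reciprocity.

(** * Reduction of rho *)

Section Reduction.

Variable q : CC.
Hypothesis q_gt0 : (0 < Cnorm q)%R.
Hypothesis q_lt1 : (Cnorm q < 1)%R.

Definition searsterm (A B C y w x : CC) (k : nat) : CC :=
  qpoch A q k * qpoch_inf (A * w * q ^ k) q
  * (qpoch B q k * qpoch C q k / (qpoch q q k * qpoch y q k)) * x ^ k.

Lemma searsterm_dominated A B C y w x : (Cnorm y < 1)%R -> (Cnorm x < 1)%R ->
  dominated (searsterm A B C y w x).
Proof.
  intros Hy Hx.
  destruct (qpoch_bounded q q_gt0 q_lt1 (Cnorm A) (Cnorm_ge0 _)) as [M1 [P1 H1]].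
  destruct (qpoch_bounded q q_gt0 q_lt1 (Cnorm B) (Cnorm_ge0 _)) as [M2 [P2 H2]].
  destruct (qpoch_bounded q q_gt0 q_lt1 (Cnorm C) (Cnorm_ge0 _)) as [M3 [P3 H3]].
  destruct (qpoch_inf_bounded q q_gt0 q_lt1 (Cnorm (A * w)) (Cnorm_ge0 _)) as [M4 [P4 H4]].
  destruct (qpoch_inv_bounded q q_gt0 q_lt1 (Cnorm q)) as [M5 [P5 H5]]; [lra|].
  destruct (qpoch_inv_bounded q q_gt0 q_lt1 (Cnorm y)) as [M6 [P6 H6]];
    [split; [apply Cnorm_ge0|assumption]|].
  apply dominated_geom with (M1 * M4 * (M2 * M3 * (M5 * M6)))%R x; [exact Hx|]. intro k.
  unfold searsterm.
  replace (qpoch B q k * qpoch C q k / (qpoch q q k * qpoch y q k))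
    with (qpoch B q k * qpoch C q k * (Cinv (qpoch q q k) * Cinv (qpoch y q k)))
    by (field; split; apply qpoch_neq0; assumption).
  rewrite !Cnorm_mul, Cnorm_pow.
  apply Rmult_le_compat_r; [apply pow_le, Cnorm_ge0|].
  specialize (H1 A k (Rle_refl _)); specialize (H2 B k (Rle_refl _)).
  specialize (H3 C k (Rle_refl _)); specialize (H4 _ (mul_qpow_norm_le q q_gt0 q_lt1 (A * w) k)).
  specialize (H5 q k (Rle_refl _)); specialize (H6 y k (Rle_refl _)).
  repeat (apply Rmult_le_compat; repeat apply Rmult_le_pos; try apply Cnorm_ge0; try assumption).
Qed.

Lemma phi32_sears A B C y w :
  (Cnorm (B * C * y) < 1)%R -> (Cnorm w < 1)%R -> (Cnorm (w * y) < 1)%R ->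
  (Cnorm (A * w) < 1)%R ->
  phi32 B C A (B * C * y) (A * w) q (w * y)
  = qpoch_inf w q / (qpoch_inf (w * y) q * qpoch_inf (A * w) q)
    * Csum (searsterm A (B * y) (C * y) (B * C * y) (w * y) w).
Proof.
  intros H Hw Hwy HAw.
  assert (forall x, (Cnorm x < 1)%R -> qpoch_inf x q <> C0) as NZ
    by (intros; apply qpoch_inf_neq0; assumption).
  pose proof (sears_transformation q A B C y w q_gt0 q_lt1 H Hw Hwy) as S.
  assert (phi32 B C A (B * C * y) (A * w) q (w * y)
    = Cinv (qpoch_inf (A * w) q) * Csum (searsterm A B C (B * C * y) w (w * y))) as ->.
  { rewrite <- Csum_scal by (apply searsterm_dominated; assumption).
    apply Csum_ext; intro k; unfold searsterm.
    rewrite (qpoch_inf_split q q_gt0 q_lt1 (A * w) k).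
    field; repeat split; try (apply qpoch_neq0; assumption).
    apply NZ, mul_qpow_norm_lt1; assumption. }
  assert (Csum (searsterm A B C (B * C * y) w (w * y))
    = (qpoch_inf (w * y) q * Csum (searsterm A B C (B * C * y) w (w * y)))
      / qpoch_inf (w * y) q) as -> by (field; auto).
  unfold searsterm at 1; rewrite S.
  unfold searsterm; field; auto.
Qed.

Section RhoSeries.

Variables a b c d r u v : CC.
Hypothesis u_neq0 : u <> C0.
Hypothesis v_neq0 : v <> C0.
Hypothesis c_neq0 : c <> C0.
Hypothesis d_neq0 : d <> C0.
Hypothesis r_neq0 : r <> C0.
Hypothesis au_lt1 : (Cnorm (a * u) < 1)%R.
Hypothesis av_lt1 : (Cnorm (a * v) < 1)%R.
Hypothesis bu_lt1 : (Cnorm (b * u) < 1)%R.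
Hypothesis bv_lt1 : (Cnorm (b * v) < 1)%R.
Hypothesis cv_lt1 : (Cnorm (c * v) < 1)%R.
Hypothesis dv_lt1 : (Cnorm (d * v) < 1)%R.
Hypothesis z_lt1 : (Cnorm (a * b * c * r * u * v / q) < 1)%R.

Let NZ0 : q <> C0 := q_neq0 q q_gt0.

Lemma hpoch_qpoch n : hpoch q c u v n = qpoch (q / (c * u)) q n * (c * v) ^ n.
Proof.
  induction n as [|n IH]; [unfold hpoch, qpoch; simpl; ring|].
  change (hpoch q c u v (S n)) with (hpoch q c u v n * (c * v - q ^ S n * v / u)).
  rewrite IH, qpoch_S; simpl Cpow; field; split; assumption.
Qed.

(** The transformation with A = q: (q)_n cancels, and the infinite product supplies (cv)_(n+1) or
    (dvq^k)_(n+1). The choice y = d q^k / c exchanges the arguments cv and dvq^k. At k = 0 it is the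
    symmetry of the case b = 0 in c and d. *)
Lemma rsum_exchange k :
  Csum (fun n => qpoch (q / (d * u)) q n * qpoch (a * c * u * v) q n * (d * v * q ^ k) ^ n
                 / (qpoch (c * v) q (S n) * qpoch (a * v * q ^ k) q (S n)))
  = Csum (fun n => qpoch (q / (c * u) * q ^ k) q n * qpoch (a * d * u * v * q ^ k) q n * (c * v) ^ n
                   / (qpoch (a * v * q ^ k) q (S n) * qpoch (d * v * q ^ k) q (S n))).
Proof.
  assert (forall x, (Cnorm x < 1)%R -> qpoch_inf x q <> C0) as NZ
    by (intros; apply qpoch_inf_neq0; assumption).
  assert (Cnorm (a * v * q ^ k) < 1)%R as Hav by (apply mul_qpow_norm_lt1; assumption).
  assert (Cnorm (d * v * q ^ k) < 1)%R as Hdv by (apply mul_qpow_norm_lt1; assumption).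
  assert (Cnorm (a * v * q ^ k * q) < 1)%R as Havq.
  { replace (a * v * q ^ k * q) with (a * v * q ^ k * q ^ 1) by (simpl; ring).
    apply mul_qpow_norm_lt1; assumption. }
  assert (C1 - a * v * q ^ k <> C0) as N1 by (apply one_sub_neq0; exact Hav).
  set (B := q / (d * u)). set (C := a * c * u * v). set (y := d * q ^ k / c).
  assert (B * C * y = a * v * q ^ k * q) as EB
    by (unfold B, C, y; field; repeat split; assumption).
  assert (c * v * y = d * v * q ^ k) as Ew by (unfold y; field; assumption).
  assert (B * y = q / (c * u) * q ^ k) as EBy by (unfold B, y; field; repeat split; assumption).
  assert (C * y = a * d * u * v * q ^ k) as ECy by (unfold C, y; field; assumption).
  pose proof (sears_transformation q q B C y (c * v) q_gt0 q_lt1) as S.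
  rewrite EB, Ew, EBy, ECy in S. specialize (S Havq cv_lt1 Hdv).
  fold (searsterm q B C (a * v * q ^ k * q) (c * v) (d * v * q ^ k)) in S.
  fold (searsterm q (q / (c * u) * q ^ k) (a * d * u * v * q ^ k) (a * v * q ^ k * q)
          (d * v * q ^ k) (c * v)) in S.
  assert (forall x B C w, (Cnorm x < 1)%R -> (Cnorm w < 1)%R ->
    Csum (fun n => qpoch B q n * qpoch C q n * x ^ n
                   / (qpoch w q (Datatypes.S n) * qpoch (a * v * q ^ k) q (Datatypes.S n)))
    = Cinv (qpoch_inf w q * (C1 - a * v * q ^ k))
      * Csum (searsterm q B C (a * v * q ^ k * q) w x)) as T.
  { clear - q_gt0 q_lt1 Hav Havq N1 NZ. intros x B C w Hx Hw.
    rewrite <- Csum_scal by (apply searsterm_dominated; assumption).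
    apply Csum_ext; intro n; unfold searsterm.
    rewrite (qpoch_inf_split q q_gt0 q_lt1 w (S n)), (qpoch_recl (a * v * q ^ k)).
    replace (q * w * q ^ n) with (w * q ^ S n) by (simpl; ring).
    field; repeat split; try (apply qpoch_neq0; assumption); try assumption.
    apply NZ, mul_qpow_norm_lt1; assumption. }
  rewrite (T (d * v * q ^ k) B C (c * v) Hdv cv_lt1).
  transitivity (Csum (fun n => qpoch (q / (c * u) * q ^ k) q n
     * qpoch (a * d * u * v * q ^ k) q n * (c * v) ^ n
     / (qpoch (d * v * q ^ k) q (Datatypes.S n) * qpoch (a * v * q ^ k) q (Datatypes.S n)))).
  2:{ apply Csum_ext; intro n; field; split; apply qpoch_neq0; assumption. }
  rewrite (T (c * v) (q / (c * u) * q ^ k) (a * d * u * v * q ^ k) (d * v * q ^ k) cv_lt1 Hdv).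
  set (X := Csum (searsterm q B C (a * v * q ^ k * q) (c * v) (d * v * q ^ k))) in *.
  set (Y := Csum (searsterm q (q / (c * u) * q ^ k) (a * d * u * v * q ^ k) (a * v * q ^ k * q)
          (d * v * q ^ k) (c * v))) in *.
  assert (X = qpoch_inf (c * v) q * Y / qpoch_inf (d * v * q ^ k) q) as ->
    by (rewrite <- S; field; auto).
  field; auto.
Qed.

Definition rho_dterm (n k : nat) : CC :=
  qpoch (q / (d * u)) q n * (d * v) ^ n * qpoch (a * c * u * v) q n / qpoch (c * v) q (S n)
  * (qpoch (q / (c * u)) q k * qpoch_inf (a * r * (b * v) * q ^ k) q * qpoch (a * r) q k
     / (qpoch q q k * qpoch (a * v * q ^ k) q (S n)) * (b * c * u * v * q ^ n) ^ k).

Lemma bcuv_lt1 : (Cnorm (b * c * u * v) < 1)%R.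
Proof. apply aduv_norm_lt1; assumption. Qed.

(** The two indices are coupled only by (avq^k)_(n+1) and q^(nk). The inverse of the former is
    bounded uniformly and the latter has modulus at most 1, so a product of geometric majorants with
    ratios |dv| and |bcuv| works. *)
Lemma rho_dterm_bounded : exists A B, summable A /\ summable B /\
  forall n k, (Cnorm (rho_dterm n k) <= A n * B k)%R.
Proof.
  destruct (qpoch_bounded q q_gt0 q_lt1 (Cnorm (q / (d * u))) (Cnorm_ge0 _)) as [M1 [P1 H1]].
  destruct (qpoch_bounded q q_gt0 q_lt1 (Cnorm (a * c * u * v)) (Cnorm_ge0 _)) as [M2 [P2 H2]].
  destruct (qpoch_inv_bounded q q_gt0 q_lt1 (Cnorm (c * v))) as [M3 [P3 H3]];
    [split; [apply Cnorm_ge0|assumption]|].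
  destruct (qpoch_bounded q q_gt0 q_lt1 (Cnorm (q / (c * u))) (Cnorm_ge0 _)) as [M4 [P4 H4]].
  destruct (qpoch_inf_bounded q q_gt0 q_lt1 (Cnorm (a * r * (b * v))) (Cnorm_ge0 _)) as [M5 [P5 H5]].
  destruct (qpoch_bounded q q_gt0 q_lt1 (Cnorm (a * r)) (Cnorm_ge0 _)) as [M6 [P6 H6]].
  destruct (qpoch_inv_bounded q q_gt0 q_lt1 (Cnorm q)) as [M7 [P7 H7]]; [lra|].
  destruct (qpoch_inv_bounded q q_gt0 q_lt1 (Cnorm (a * v))) as [M8 [P8 H8]];
    [split; [apply Cnorm_ge0|assumption]|].
  exists (fun n => M1 * M2 * M3 * Cnorm (d * v) ^ n)%R,
    (fun k => M4 * M5 * M6 * (M7 * M8) * Cnorm (b * c * u * v) ^ k)%R.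
  repeat split.
  - apply summable_scal; [repeat apply Rmult_le_pos; lra|].
    apply summable_geom; split; [apply Cnorm_ge0|assumption].
  - apply summable_scal; [repeat apply Rmult_le_pos; lra|].
    apply summable_geom; split; [apply Cnorm_ge0|assumption].
  - apply summable_scal; [repeat apply Rmult_le_pos; lra|].
    apply summable_geom; split; [apply Cnorm_ge0|apply bcuv_lt1].
  - apply summable_scal; [repeat apply Rmult_le_pos; lra|].
    apply summable_geom; split; [apply Cnorm_ge0|apply bcuv_lt1].
  - intros n k.
    assert (Cnorm (a * v * q ^ k) < 1)%R as Hav by (apply mul_qpow_norm_lt1; assumption).
    replace (rho_dterm n k) with
      ((qpoch (q / (d * u)) q n * qpoch (a * c * u * v) q n * Cinv (qpoch (c * v) q (S n))
        * (d * v) ^ n)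
       * (qpoch (q / (c * u)) q k * qpoch_inf (a * r * (b * v) * q ^ k) q * qpoch (a * r) q k
          * (Cinv (qpoch q q k) * Cinv (qpoch (a * v * q ^ k) q (S n)))
          * (b * c * u * v * q ^ n) ^ k))
      by (unfold rho_dterm; field; repeat split; try assumption; apply qpoch_neq0; assumption).
    rewrite (Cnorm_mul (_ * (d * v) ^ n)), (Cnorm_mul _ ((d * v) ^ n)),
      (Cnorm_mul _ ((b * c * u * v * q ^ n) ^ k)), !Cnorm_pow.
    apply Rmult_le_compat; try (apply Rmult_le_pos; [apply Cnorm_ge0|apply pow_le, Cnorm_ge0]).
    + apply Rmult_le_compat_r; [apply pow_le, Cnorm_ge0|].
      specialize (H1 _ n (Rle_refl _)); specialize (H2 _ n (Rle_refl _)).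
      specialize (H3 _ (S n) (Rle_refl _)). rewrite !Cnorm_mul in *.
      repeat (apply Rmult_le_compat; repeat apply Rmult_le_pos; try apply Cnorm_ge0; try assumption).
    + specialize (H4 _ k (Rle_refl _)).
      specialize (H5 _ (mul_qpow_norm_le q q_gt0 q_lt1 (a * r * (b * v)) k)).
      specialize (H6 _ k (Rle_refl _)); specialize (H7 _ k (Rle_refl _)).
      specialize (H8 _ (S n) (mul_qpow_norm_le q q_gt0 q_lt1 (a * v) k)).
      apply Rmult_le_compat; try apply Cnorm_ge0; try (apply pow_le, Cnorm_ge0).
      * rewrite (Cnorm_mul _ (_ * Cinv _)), (Cnorm_mul (Cinv _)),
          (Cnorm_mul _ (qpoch (a * r) q k)), (Cnorm_mul (qpoch (q / (c * u)) q k)).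
        repeat (apply Rmult_le_compat; repeat apply Rmult_le_pos; try apply Cnorm_ge0; try assumption).
      * apply pow_incr; split; [apply Cnorm_ge0|apply mul_qpow_norm_le; assumption].
Qed.

(** The parameters of the transformation are chosen so that B y = ar and C y = av no longer depend
    on n. The prefactors (bcuvq^n)_oo and (bvq^(n+1))_oo combine with the outer (bcuv)_n and
    (bv)_(n+1) into constants. *)
Lemma rho_dterm_row n :
  ((qpoch (q / (d * u)) q n * qpoch (a * c * u * v) q n * qpoch (b * c * u * v) q n
        * (d * v) ^ n)
     / (qpoch (a * v) q (S n) * qpoch (b * v) q (S n) * qpoch (c * v) q (S n)))
    * phi32 (q ^ (S n)) (v * q ^ (S n) / r) (q / (c * u))
            (a * v * q ^ (S n)) (b * v * q ^ (S n)) q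
            (a * b * c * r * u * v / q)
  = qpoch_inf (b * c * u * v) q
      / (qpoch_inf (a * b * c * r * u * v / q) q * qpoch_inf (b * v) q)
    * Csum (rho_dterm n).
Proof.
  pose proof bcuv_lt1 as bcuv.
  assert (forall x, (Cnorm x < 1)%R -> qpoch_inf x q <> C0) as NZ
    by (intros; apply qpoch_inf_neq0; assumption).
  assert (q ^ n <> C0) as Nq by (apply Cpow_neq0, NZ0).
  pose (A := q / (c * u)). pose (B := q ^ S n). pose (C := v * q ^ S n / r).
  pose (y := a * r / q ^ S n). pose (w := b * c * u * v * q ^ n).
  assert (a * v * q ^ S n = B * C * y) as EB
    by (unfold B, C, y; simpl; field; repeat split; assumption).
  assert (b * v * q ^ S n = A * w) as EA
    by (unfold A, w; simpl; field; repeat split; assumption).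
  assert (a * b * c * r * u * v / q = w * y) as Ew
    by (unfold w, y; simpl; field; repeat split; assumption).
  assert (B * y = a * r) as EBy by (unfold B, y; simpl; field; repeat split; assumption).
  assert (C * y = a * v) as ECy by (unfold C, y; simpl; field; repeat split; assumption).
  assert (A * (w * y) = a * r * (b * v)) as EAw
    by (unfold A, w, y; simpl; field; repeat split; assumption).
  assert (Cnorm w < 1)%R as Hw by (apply mul_qpow_norm_lt1; assumption).
  assert (Cnorm (A * w) < 1)%R as HAw by (rewrite <- EA; apply mul_qpow_norm_lt1; assumption).
  assert (Cnorm (a * v * q ^ S n) < 1)%R as Hav by (apply mul_qpow_norm_lt1; assumption).
  assert (phi32 (q ^ S n) (v * q ^ S n / r) (q / (c * u)) (a * v * q ^ S n) (b * v * q ^ S n) q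
            (a * b * c * r * u * v / q) = phi32 B C A (B * C * y) (A * w) q (w * y)) as ->
    by (rewrite <- EB, <- EA, <- Ew; reflexivity).
  rewrite phi32_sears; try assumption; try (rewrite <- EB; assumption);
    try (rewrite <- Ew; assumption).
  set (K1 := qpoch (q / (d * u)) q n * (d * v) ^ n * qpoch (a * c * u * v) q n
             / (qpoch (a * v) q (S n) * qpoch (c * v) q (S n))).
  rewrite EBy, ECy.
  assert (Csum (rho_dterm n) = K1 * Csum (searsterm A (a * r) (a * v) (B * C * y) (w * y) w)) as ->.
  { rewrite <- Csum_scal by (apply searsterm_dominated; [rewrite <- EB|]; assumption).
    apply Csum_ext; intro k; unfold rho_dterm, K1, searsterm.
    rewrite EAw, <- EB. fold A w.
    (* Two splittings of (av)_(n+k+1): they move the dependence on n into (avq^k)_(n+1), which suits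
       the sum over n. *)
    pose proof (qpoch_add (a * v) q (S n) k) as Q1.
    pose proof (qpoch_add (a * v) q k (S n)) as Q2.
    rewrite Nat.add_comm, Q1 in Q2.
    assert (Cnorm (a * v * q ^ k) < 1)%R as Hav' by (apply mul_qpow_norm_lt1; assumption).
    assert (qpoch (a * v * q ^ k) q (S n) = qpoch (a * v) q (S n) * qpoch (a * v * q ^ S n) q k
      / qpoch (a * v) q k) as -> by (rewrite Q2; field; apply qpoch_neq0; assumption).
    field; repeat split; apply qpoch_neq0; assumption. }
  rewrite (qpoch_inf_split q q_gt0 q_lt1 (b * c * u * v) n).
  rewrite (qpoch_inf_split q q_gt0 q_lt1 (b * v) (S n)).
  rewrite EA, Ew. fold w. unfold K1.
  assert (qpoch_inf (w * y) q <> C0) by (rewrite <- Ew; auto).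
  field; repeat split; auto; apply qpoch_neq0; assumption.
Qed.

(** After [rsum_exchange] the powers q^k are those produced by (x)_(k+n) = (x)_k (xq^k)_n in [rterm]
    of index k + n. The column is therefore a multiple of the tail of the series from index k on. *)
Lemma rho_dterm_col k : Csum (fun n => rho_dterm n k)
  = sterm q (a * r) a d b u v (fun _ => C1) k
    * (Csum (rterm q a c d u v) - Cpartial (rterm q a c d u v) k).
Proof.
  assert (Cnorm (a * v * q ^ k) < 1)%R as Hav by (apply mul_qpow_norm_lt1; assumption).
  assert (Cnorm (d * v * q ^ k) < 1)%R as Hdv by (apply mul_qpow_norm_lt1; assumption).
  assert (Cnorm (a * d * u * v) < 1)%R as Had by (apply aduv_norm_lt1; assumption).
  assert (Cnorm (a * d * u * v * q ^ k) < 1)%R as Hadk by (apply mul_qpow_norm_lt1; assumption).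
  rewrite <- Csum_tail by (apply rterm_dominated; assumption).
  set (K1 := qpoch (q / (c * u)) q k * qpoch_inf (a * r * (b * v) * q ^ k) q * qpoch (a * r) q k
     / qpoch q q k * (b * c * u * v) ^ k).
  destruct rho_dterm_bounded as [SA [SB [HA [HB HAB]]]].
  assert (dominated (fun n => rterm q a c d u v (k + n))) as DT.
  { destruct (small_majorant q q_gt0 q_lt1 _ cv_lt1) as [z [Z0 [Z1 Hz]]].
    destruct (rterm_bounded q q_gt0 q_lt1 a d u v z Z0 av_lt1 dv_lt1) as [M [M0 HM]].
    apply dominated_geom with (M * Cnorm z ^ k)%R z; [exact Z1|]. intro n.
    eapply Rle_trans; [apply HM; [apply Rle_refl|exact Hz]|].
    rewrite pow_add; apply Req_le; ring. }
  set (g := fun n => qpoch (q / (d * u)) q n * qpoch (a * c * u * v) q n * (d * v * q ^ k) ^ n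
                 / (qpoch (c * v) q (S n) * qpoch (a * v * q ^ k) q (S n))).
  assert (dominated g) as Dg.
  { destruct (qpoch_bounded q q_gt0 q_lt1 (Cnorm (q / (d * u))) (Cnorm_ge0 _)) as [M1 [P1 H1]].
    destruct (qpoch_bounded q q_gt0 q_lt1 (Cnorm (a * c * u * v)) (Cnorm_ge0 _)) as [M2 [P2 H2]].
    destruct (qpoch_inv_bounded q q_gt0 q_lt1 (Cnorm (c * v))) as [M3 [P3 H3]];
      [split; [apply Cnorm_ge0|assumption]|].
    destruct (qpoch_inv_bounded q q_gt0 q_lt1 (Cnorm (a * v * q ^ k))) as [M4 [P4 H4]];
      [split; [apply Cnorm_ge0|assumption]|].
    apply dominated_geom with (M1 * M2 * (M3 * M4))%R (d * v * q ^ k); [exact Hdv|]. intro n.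
    assert (g n = qpoch (q / (d * u)) q n * qpoch (a * c * u * v) q n
      * (Cinv (qpoch (c * v) q (S n)) * Cinv (qpoch (a * v * q ^ k) q (S n)))
      * (d * v * q ^ k) ^ n) as ->
      by (unfold g; field; repeat split; try assumption; apply qpoch_neq0; assumption).
    specialize (H1 _ n (Rle_refl _)); specialize (H2 _ n (Rle_refl _)).
    specialize (H3 _ (S n) (Rle_refl _)); specialize (H4 _ (S n) (Rle_refl _)).
    rewrite (Cnorm_mul _ ((d * v * q ^ k) ^ n)), Cnorm_pow.
    apply Rmult_le_compat_r; [apply pow_le, Cnorm_ge0|].
    rewrite (Cnorm_mul _ (Cinv _ * _)), (Cnorm_mul (Cinv _)), (Cnorm_mul (qpoch _ q n)).
    repeat (apply Rmult_le_compat; repeat apply Rmult_le_pos; try apply Cnorm_ge0; try assumption). }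
  transitivity (K1 * Csum g).
  { rewrite <- Csum_scal by exact Dg. apply Csum_ext; intro n.
    unfold rho_dterm, K1, g.
    rewrite !Cpow_mul_base, (Cpow_pow_comm q n k).
    field; repeat split; try assumption; apply qpoch_neq0; assumption. }
  unfold g; rewrite rsum_exchange.
  set (h := fun n => rterm q a c d u v (k + n)) in *.
  set (K2 := hpoch q c u v k * qpoch (a * d * u * v) q k / (qpoch (a * v) q k * qpoch (d * v) q k)).
  assert (forall n, h n = K2 * (qpoch (q / (c * u) * q ^ k) q n * qpoch (a * d * u * v * q ^ k) q n
     * (c * v) ^ n / (qpoch (a * v * q ^ k) q (S n) * qpoch (d * v * q ^ k) q (S n)))) as Eh.
  { intro n; unfold h, K2, rterm.
    rewrite !hpoch_qpoch, Cpow_add, <- !Nat.add_succ_r, !qpoch_add.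
    field; repeat split; apply qpoch_neq0; assumption. }
  rewrite <- !Csum_scal; [apply Csum_ext; intro n|exact DT|].
  - rewrite Eh. unfold K1, K2, sterm. rewrite hpoch_qpoch, !Cpow_mul_base.
    field; repeat split; apply qpoch_neq0; assumption.
  - destruct (qpoch_bounded q q_gt0 q_lt1 (Cnorm (q / (c * u) * q ^ k)) (Cnorm_ge0 _))
      as [M1 [P1 H1]].
    destruct (qpoch_bounded q q_gt0 q_lt1 (Cnorm (a * d * u * v * q ^ k)) (Cnorm_ge0 _))
      as [M2 [P2 H2]].
    destruct (qpoch_inv_bounded q q_gt0 q_lt1 (Cnorm (a * v * q ^ k))) as [M3 [P3 H3]];
      [split; [apply Cnorm_ge0|assumption]|].
    destruct (qpoch_inv_bounded q q_gt0 q_lt1 (Cnorm (d * v * q ^ k))) as [M4 [P4 H4]];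
      [split; [apply Cnorm_ge0|assumption]|].
    apply dominated_geom with (M1 * M2 * (M3 * M4))%R (c * v); [exact cv_lt1|]. intro n.
    replace (qpoch (q / (c * u) * q ^ k) q n * qpoch (a * d * u * v * q ^ k) q n
     * (c * v) ^ n / (qpoch (a * v * q ^ k) q (S n) * qpoch (d * v * q ^ k) q (S n)))
    with (qpoch (q / (c * u) * q ^ k) q n * qpoch (a * d * u * v * q ^ k) q n
     * (Cinv (qpoch (a * v * q ^ k) q (S n)) * Cinv (qpoch (d * v * q ^ k) q (S n))) * (c * v) ^ n)
      by (field; repeat split; try assumption; apply qpoch_neq0; assumption).
    specialize (H1 _ n (Rle_refl _)); specialize (H2 _ n (Rle_refl _)).
    specialize (H3 _ (S n) (Rle_refl _)); specialize (H4 _ (S n) (Rle_refl _)).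
    rewrite (Cnorm_mul _ ((c * v) ^ n)), Cnorm_pow.
    apply Rmult_le_compat_r; [apply pow_le, Cnorm_ge0|].
    rewrite (Cnorm_mul _ (Cinv _ * _)), (Cnorm_mul (Cinv _)), (Cnorm_mul (qpoch _ q n)).
    repeat (apply Rmult_le_compat; repeat apply Rmult_le_pos; try apply Cnorm_ge0; try assumption).
Qed.

Lemma rtail_bounded : exists M, forall k,
  (Cnorm (v * Cpartial (rterm q a c d u v) k) <= M)%R.
Proof.
  apply Ccv_bounded with (v * Csum (rterm q a c d u v)).
  apply Ccv_scal, Csum_cv, rterm_dominated; assumption.
Qed.

Lemma rho_reduction :
  rho q a b c d r u v = qpoch_inf (b * c * u * v) q
      / (qpoch_inf (a * b * c * r * u * v / q) q * qpoch_inf (b * v) q)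
    * (v * Csum (rterm q a c d u v) * Csum (sterm q (a * r) a d b u v (fun _ => C1))
       - Csum (sterm q (a * r) a d b u v (fun k => v * Cpartial (rterm q a c d u v) k))).
Proof.
  assert (Cnorm (a * d * u * v) < 1)%R as Had by (apply aduv_norm_lt1; assumption).
  destruct rho_dterm_bounded as [SA [SB [HA [HB HAB]]]].
  unfold rho. rewrite (Csum_ext _ _ rho_dterm_row).
  rewrite Csum_scal by (apply (dominated_rowsum rho_dterm SA SB); assumption).
  rewrite (Csum_swap rho_dterm SA SB) by assumption.
  rewrite (Csum_ext _ _ rho_dterm_col).
  set (K := qpoch_inf (b * c * u * v) q
      / (qpoch_inf (a * b * c * r * u * v / q) q * qpoch_inf (b * v) q)).
  set (R := Csum (rterm q a c d u v)).
  set (s1 := sterm q (a * r) a d b u v (fun _ => C1)).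
  set (sT := sterm q (a * r) a d b u v (fun k => v * Cpartial (rterm q a c d u v) k)).
  assert (dominated s1) as D1 by (apply sterm_dominated; try assumption; apply one_bounded).
  assert (dominated sT) as DT by (apply sterm_dominated; try assumption; apply rtail_bounded).
  (* [sT] carries the factor v inside its weight, as its symmetry in u and v demands; hence the
     compensating [Cinv v]. *)
  rewrite (Csum_ext _ (fun k => R * s1 k + Copp (Cinv v) * sT k)).
  - rewrite Csum_add, !Csum_scal by (try apply dominated_scal; assumption).
    field; exact v_neq0.
  - intro k; unfold s1, sT, sterm; field; repeat split; try assumption;
      apply qpoch_neq0; assumption.
Qed.

End RhoSeries.

End Reduction.

Theorem mainTheorem4 (q a b c d r u v : CC) :
  (0 < Cnorm q)%R -> (Cnorm q < 1)%R ->
  u <> C0 -> v <> C0 ->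
  c <> C0 -> d <> C0 -> r <> C0 ->
  (Cnorm (a * u) < 1)%R -> (Cnorm (a * v) < 1)%R ->
  (Cnorm (b * u) < 1)%R -> (Cnorm (b * v) < 1)%R ->
  (Cnorm (c * u) < 1)%R -> (Cnorm (c * v) < 1)%R ->
  (Cnorm (d * u) < 1)%R -> (Cnorm (d * v) < 1)%R ->
  (Cnorm (a * b * r / d) < 1)%R ->
  (Cnorm (a * b * c * r * u * v / q) < 1)%R ->
  (rho q a b c d r u v - rho q a b c d r v u) =
  ((qDelta q u v
     * qpoch_inf (a * c * u * v) q * qpoch_inf (a * d * u * v) q
     * qpoch_inf (b * c * u * v) q * qpoch_inf (b * d * u * v) q
     * qpoch_inf (c * d * u * v) q * qpoch_inf (a * b * r / d) q)
   / (qpoch_inf (a * u) q * qpoch_inf (a * v) q * qpoch_inf (b * u) q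
     * qpoch_inf (b * v) q * qpoch_inf (c * u) q * qpoch_inf (c * v) q
     * qpoch_inf (d * u) q * qpoch_inf (d * v) q
     * qpoch_inf (a * b * c * r * u * v / q) q)
   * phi32 (d * u) (d * v) (d * u * v / r) (a * d * u * v) (b * d * u * v) q
           (a * b * r / d)).
Proof.
  intros q0 q1 Hu Hv Hc Hd Hr au av bu bv cu cv du dv Hz' Hz.
  assert (forall x, (Cnorm x < 1)%R -> qpoch_inf x q <> C0) as NZ
    by (intros; apply qpoch_inf_neq0; assumption).
  assert (Cnorm (a * d * u * v) < 1)%R as aduv by (apply aduv_norm_lt1; assumption).
  assert (Cnorm (b * d * u * v) < 1)%R as bduv by (apply aduv_norm_lt1; assumption).
  assert (a * b * c * r * v * u / q = a * b * c * r * u * v / q) as Ez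
    by (field; apply q_neq0; assumption).
  rewrite (rho_reduction q q0 q1 a b c d r u v) by assumption.
  rewrite (rho_reduction q q0 q1 a b c d r v u) by (try rewrite Ez; assumption).
  rewrite Ez. replace (b * c * v * u) with (b * c * u * v) by ring.
  pose proof (Csum_sterm_sym q (a * r) a d b u v _ _ q0 q1 aduv bu bv one_bounded one_bounded
    (conv1_sym q a d u v q0 q1 aduv)) as S1.
  pose proof (Csum_sterm_sym q (a * r) a d b u v _ _ q0 q1 aduv bu bv
    (rtail_bounded q q0 q1 a c d u v av cv dv) (rtail_bounded q q0 q1 a c d v u au cu du)
    (fun n => conv_tail_sym q a c d u v n q0 q1 Hu Hv aduv au av du dv)) as ST.
  pose proof (recip_product q q0 q1 a c d u v Hu Hv au av cu cv du dv) as RP.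
  unfold recip in RP.
  (* The right-hand series is Psi up to a factor: [phi32_sears] with A = dv, B = du, C = duv/r, y =
     ar/(du), w = bu, where wy = abr/d and Aw = bduv. *)
  assert (phi32 (d * u) (d * v) (d * u * v / r) (a * d * u * v) (b * d * u * v) q (a * b * r / d)
    = qpoch_inf (b * u) q / (qpoch_inf (a * b * r / d) q * qpoch_inf (b * d * u * v) q)
      * Csum (sterm q (a * r) a d b u v (fun _ => C1))) as P.
  { assert (d * u * (d * u * v / r) * (a * r / (d * u)) = a * d * u * v) as E1
      by (field; repeat split; assumption).
    assert (b * u * (a * r / (d * u)) = a * b * r / d) as E2
      by (field; repeat split; assumption).
    assert (d * v * (b * u) = b * d * u * v) as E3 by ring.
    transitivity (phi32 (d * u) (d * u * v / r) (d * v)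
      (d * u * (d * u * v / r) * (a * r / (d * u))) (d * v * (b * u)) q
      (b * u * (a * r / (d * u)))).
    - rewrite E1, E2, E3. apply Csum_ext; intro k. f_equal; ring.
    - rewrite phi32_sears; rewrite ?E1, ?E2, ?E3; try assumption.
      f_equal. apply Csum_ext; intro k; unfold searsterm, sterm.
      replace (d * u * (a * r / (d * u))) with (a * r) by (field; repeat split; assumption).
      replace (d * u * v / r * (a * r / (d * u))) with (a * v) by (field; repeat split; assumption).
      replace (d * v * (a * b * r / d)) with (a * r * (b * v)) by (field; assumption).
      field; split; apply qpoch_neq0; assumption. }
  rewrite P.
  set (s1 := Csum (sterm q (a * r) a d b u v (fun _ => C1))) in *.
  set (s1' := Csum (sterm q (a * r) a d b v u (fun _ => C1))) in *.
  set (sT := Csum (sterm q (a * r) a d b u v (fun k => v * Cpartial (rterm q a c d u v) k))) in *.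
  set (sT' := Csum (sterm q (a * r) a d b v u (fun k => u * Cpartial (rterm q a c d v u) k))) in *.
  (* The quotient (bu)_oo/(bv)_oo turns the factor 1/(bu)_oo of the exchanged expression into
     1/(bv)_oo. Both expressions then have the same prefactor, and the [sT] terms cancel. *)
  assert (s1' = qpoch_inf (b * u) q * s1 / qpoch_inf (b * v) q) as -> by (rewrite S1; field; auto).
  assert (sT' = qpoch_inf (b * u) q * sT / qpoch_inf (b * v) q) as -> by (rewrite ST; field; auto).
  transitivity (qpoch_inf (b * c * u * v) q
    / (qpoch_inf (a * b * c * r * u * v / q) q * qpoch_inf (b * v) q) * s1
    * (v * Csum (rterm q a c d u v) - u * Csum (rterm q a c d v u))).
  - field; repeat split; auto.
  - rewrite RP. field; repeat split; auto.
Qed.
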